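(* Let $m$ and $n$ be positive integers, let $k$ be an integer with $0\le k\le m$, and let $\kappa=m+n$. For $r\ge 0$ let $(m^r,k)$ denote the partition with $r$ parts equal to $m$ followed by one part equal to $k$ (omitted if $k=0$). Then, as formal power series in $q$, \[ \lim_{r\to\infty} q^{-m\binom{r}{2}-kr} Q_{(m^r,k)}(1,q,q^2,\dots;q^n) =\frac{(q^n;q^n)_{\infty} (q^{\kappa};q^{\kappa})_{\infty}^{n-1}}{(q;q)_{\infty}^n} \prod_{i=1}^{n-1} \theta(q^{i+k};q^{\kappa}) \prod_{1\leq i<j\leq n-1} \theta(q^{j-i};q^{\kappa}). \]
   Context: For a partition $\lambda$, $l(\lambda)$ is the number of positive parts and $m_i=m_i(\lambda)$ is the multiplicity of parts equal to $i$. Notation: $(a;q)_k=(1-a)(1-aq)\cdots(1-aq^{k-1})$ for $k\in\{0,1,2,\dots\}\cup\{\infty\}$; $\theta(a;q)=(a;q)_\infty(q/a;q)_\infty$. The Hall–Littlewood polynomial in $N$ variables $x=(x_1,\dots,x_N)$ with parameter $t$ is $P_\lambda(x;t)=\frac{1}{v_\lambda(t)}\sum_{w\in S_N} w\Big(x_1^{\lambda_1}\cdots x_N^{\lambda_N}\prod_{i<j}\frac{x_i-tx_j}{x_i-x_j}\Big)$ for $l(\lambda)\le N$, where $S_N$ permutes the variables and $v_\lambda(t)=\prod_{i=0}^N (t;t)_{m_i}/(1-t)^{m_i}$ with $m_0=N-l(\lambda)$; $P_\lambda(x;t)=0$ if $l(\lambda)>N$. These are stable under setting $x_N=0$ and so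 define symmetric functions in infinitely many variables. Further $Q_\lambda(x;t)=b_\lambda(t)P_\lambda(x;t)$ with $b_\lambda(t)=\prod_{i\ge1}(t;t)_{m_i(\lambda)}$. $Q_\lambda(1,q,q^2,\dots;t)$ denotes the specialisation $x_i=q^{i-1}$ ($i\ge1$), a formal power series in $q$; the limit is coefficientwise. *)

(* Defs.v *)
From HB Require Import structures.
From mathcomp Require Import all_boot all_order all_fingroup all_algebra.
From mathcomp Require Import boolp classical_sets.

Set Implicit Arguments.
Unset Strict Implicit.
Unset Printing Implicit Defensive.

Import GRing.Theory.
Local Open Scope ring_scope.

Record fps (R : Type) := Fps { fcoef : nat -> R }.
Arguments Fps {R}.

HB.instance Definition _ (R : Type) := gen_eqMixin (fps R).
HB.instance Definition _ (R : Type) := gen_choiceMixin (fps R).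

Lemma fpsP (R : Type) (f g : fps R) : fcoef f =1 fcoef g -> f = g.
Proof. by case: f g => [f] [g] /= /funext->. Qed.

Section FpsRing.
Variable R : idomainType.
Implicit Types f g h : fps R.

Definition fps_zero : fps R := Fps (fun=> 0).
Definition fps_opp f : fps R := Fps (fun d => - fcoef f d).
Definition fps_add f g : fps R := Fps (fun d => fcoef f d + fcoef g d).
Definition fps_one : fps R := Fps (fun d => (d == 0)%:R).
Definition fps_mul f g : fps R :=
  Fps (fun d => \sum_(i < d.+1) fcoef f i * fcoef g (d - i)%N).

Let fps_addA : associative fps_add.
Proof. by move=> f g h; apply: fpsP => d /=; rewrite addrA. Qed.
Let fps_addC : commutative fps_add.
Proof. by move=> f g; apply: fpsP => d /=; rewrite addrC. Qed.
Let fps_add0 : left_id fps_zero fps_add.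
Proof. by move=> f; apply: fpsP => d /=; rewrite add0r. Qed.
Let fps_addN : left_inverse fps_zero fps_opp fps_add.
Proof. by move=> f; apply: fpsP => d /=; rewrite addNr. Qed.

HB.instance Definition _ :=
  GRing.isZmodule.Build (fps R) fps_addA fps_addC fps_add0 fps_addN.

Definition fps_trunc n f : {poly R} := \poly_(i < n) fcoef f i.

Lemma fps_truncM n f g d : (d < n)%N ->
  fcoef (fps_mul f g) d = (fps_trunc n f * fps_trunc n g)`_d.
Proof.
move=> ltdn; rewrite coefM; apply: eq_bigr => i _; rewrite !coef_poly.
have le_id : (i <= d)%N by rewrite -ltnS.
by rewrite (leq_ltn_trans le_id ltdn) (leq_ltn_trans (leq_subr _ _) ltdn).
Qed.

Let fps_mulC : commutative fps_mul.
Proof.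
by move=> f g; apply: fpsP => d; rewrite !(fps_truncM _ _ (ltnSn d)) mulrC.
Qed.
Let fps_mulA : associative fps_mul.
Proof.
move=> f g h; apply: fpsP => d; set t := fps_trunc d.+1.
transitivity (t f * (t g * t h))`_d.
  rewrite coefM; apply: eq_bigr => i _; rewrite coef_poly ltn_ord; congr (_ * _).
  by apply: fps_truncM; rewrite ltnS leq_subr.
rewrite mulrA coefM; apply: eq_bigr => i _.
rewrite coef_poly ltnS leq_subr; congr (_ * _).
by apply/esym/fps_truncM; apply: ltn_ord.
Qed.
Let fps_mul1 : left_id fps_one fps_mul.
Proof.
move=> f; apply: fpsP => d /=; rewrite big_ord_recl big1 ?addr0 => [|i _].
  by rewrite mul1r subn0.
by rewrite mul0r.
Qed.
Let fps_mulDl : left_distributive fps_mul fps_add.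
Proof.
move=> f g h; apply: fpsP => d /=; rewrite -big_split.
by apply: eq_bigr => i _; rewrite mulrDl.
Qed.
Let fps_one_neq0 : fps_one != 0.
Proof.
by apply/eqP => /(congr1 (fun f => fcoef f 0)) /eqP; rewrite /= oner_eq0.
Qed.

HB.instance Definition _ := GRing.Zmodule_isComNzRing.Build (fps R)
  fps_mulA fps_mulC fps_mul1 fps_mulDl fps_one_neq0.

Definition fps_unit : pred (fps R) := fun f => `[< exists g, g * f = 1 >].
Definition fps_inv f : fps R := xget f [set g | g * f = 1].

Let fps_mulVf : {in fps_unit, left_inverse 1 fps_inv *%R}.
Proof. by move=> f /asboolP/(xgetPex f). Qed.
Let fps_unitP f g : g * f = 1 -> fps_unit f.
Proof. by move=> gf1; apply/asboolP; exists g. Qed.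
Let fps_inv_out : {in [predC fps_unit], fps_inv =1 id}.
Proof.
move=> f /negP nUf; apply: xgetPN => g gf1.
exact/nUf/(fps_unitP gf1).
Qed.

HB.instance Definition _ := GRing.ComNzRing_hasMulInverse.Build (fps R)
  fps_mulVf fps_unitP fps_inv_out.

Lemma fps_neq0_order f : f != 0 ->
  exists2 i, fcoef f i != 0 & forall j, (j < i)%N -> fcoef f j = 0.
Proof.
move=> nz_f; have exf : exists i, fcoef f i != 0.
  apply: contrapT => fE; move/eqP: nz_f; apply; apply: fpsP => d /=.
  by apply: contrapT => /eqP fd; apply: fE; exists d.
exists (ex_minn exf); case: ex_minnP => // i _ min_i j lt_ji.
by apply/eqP; apply: contraTT lt_ji => /min_i; rewrite -leqNgt.
Qed.

Let fps_idomain : GRing.integral_domain_axiom (fps R).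
Proof.
move=> f g fg0; apply/norP => -[/fps_neq0_order[i fi f0] /fps_neq0_order[j gj g0]].
have /eqP := congr1 (fun h => fcoef h (i + j)) fg0; rewrite /= => fgE.
have lt_i : (i < (i + j).+1)%N by rewrite ltnS leq_addr.
move: fgE; rewrite (bigD1 (Ordinal lt_i)) //= addKn big1 ?addr0 => [|l neq_li].
  by rewrite mulf_eq0 (negPf fi) (negPf gj).
have [lt_li|lt_il|eq_li] := ltngtP l i; last 1 first.
- by case/eqP: neq_li; apply: val_inj.
- by rewrite f0 // mul0r.
by rewrite g0 ?mulr0 // ltn_subLR ?ltn_add2r // -ltnS.
Qed.

HB.instance Definition _ :=
  GRing.ComUnitRing_isIntegral.Build (fps R) fps_idomain.

End FpsRing.

(* Q((q)) is the fraction field of Q[[q]], embedded in it by [tofrac]. *)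
Notation laurent := {fraction (fps rat)}.

Definition q : laurent := tofrac (Fps (fun d => (d == 1)%:R)).

(* The terms and the limit are required to lie in Q[[q]]. *)
Definition fps_cvg (u : nat -> laurent) (l : laurent) : Prop :=
  exists (f : nat -> fps rat) (g : fps rat),
    [/\ forall r, u r = tofrac (f r),
        l = tofrac g &
        forall d, exists r0, forall r, (r0 <= r)%N -> fcoef (f r) d = fcoef g d].

Definition fps_lim (u : nat -> laurent) : laurent := xget 0 [set l | fps_cvg u l].

Lemma fps_cvg_unique u l1 l2 : fps_cvg u l1 -> fps_cvg u l2 -> l1 = l2.
Proof.
move=> [f1 [g1 [uf1 -> cv1]]] [f2 [g2 [uf2 -> cv2]]]; congr (tofrac _).
apply: fpsP => d; have [r1 c1] := cv1 d; have [r2 c2] := cv2 d.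
have f12 r : f1 r = f2 r by apply/eqP; rewrite -tofrac_eq -uf1 -uf2.
by rewrite -(c1 _ (leq_maxl r1 r2)) -(c2 _ (leq_maxr r1 r2)) f12.
Qed.

Lemma fps_cvg_lim u l : fps_cvg u l -> fps_lim u = l.
Proof.
move=> cvu; apply: xget_subset1 => // l1 l2; exact: fps_cvg_unique.
Qed.

Definition qpoch (F : fieldType) (a p : F) (k : nat) : F :=
  \prod_(0 <= i < k) (1 - a * p ^+ i).

Definition qpoch_inf (a p : laurent) : laurent := fps_lim (qpoch a p).

Definition theta (a p : laurent) : laurent :=
  qpoch_inf a p * qpoch_inf (p / a) p.

(* Partitions are weakly decreasing sequences; trailing zeros are harmless. *)
Definition plength (la : seq nat) : nat := count (ltn 0) la.

Section HallLittlewood.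
Variables (F : fieldType) (la : seq nat) (t : F).

(* The product over i >= 0 stops at the largest part, after which m_i = 0. *)
Definition hl_v (N : nat) : F :=
  let m i := if i is 0%N then (N - plength la)%N else count_mem i la in
  \prod_(0 <= i < (\max_(p <- la) p).+1) (qpoch t t (m i) / (1 - t) ^+ m i).

Definition hl_b : F :=
  \prod_(1 <= i < (\max_(p <- la) p).+1) qpoch t t (count_mem i la).

(* Value of P_la(x_0, ..., x_(N-1); t). The defining quotient can be evaluated
   term by term, so this is the value of the polynomial, only when the x_i are
   pairwise distinct and hl_v is well defined and nonzero; this holds below,
   where x_i = q^i and t = q^n with n > 0. *)
Definition hl_P (N : nat) (x : 'I_N -> F) : F :=
  if (plength la <= N)%N then
    (hl_v N)^-1 *
    \sum_(w : 'S_N)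
      ((\prod_(i < N) x (w i) ^+ nth 0%N la i) *
       \prod_(i < N) \prod_(j < N | (i < j)%N)
         ((x (w i) - t * x (w j)) / (x (w i) - x (w j))))
  else 0.

Definition hl_Q (N : nat) (x : 'I_N -> F) : F := hl_b * hl_P x.

End HallLittlewood.

(* Q_la(1, q, q^2, ...; t): the specialisation of the stable limit is the
   coefficientwise limit of the values at (1, q, ..., q^(N-1)). *)
Definition hl_Q_princ (la : seq nat) (t : laurent) : laurent :=
  fps_lim (fun N => hl_Q la t (fun i : 'I_N => q ^+ i)).

(* The partition (m^r, k). *)
Definition near_rect (m r k : nat) : seq nat :=
  nseq r m ++ (if k is 0%N then [::] else [:: k]).

(* Main.v *)
(* With x_i = q^i and t = q^n the factors x_i - t x_j kill every permutation
   that does not list each residue class mod n in increasing order.  Hence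
   Q_(m^r,k) is a sum over a in N^n with |a| = r, where a_c counts the numbers
   congruent to c among the first r entries.  As the number of variables goes
   to infinity, each summand becomes a product B(a)^-1 of reciprocal
   q-Pochhammer symbols times a power of q times an alternant, so that, up to
   explicit factors,
     Q_(m^r,k) = sum over (a, s) of sgn(s) B(a)^-1 q^E(a, s),
   with s running over S_n and E quadratic of level kappa = m + n.  Let T(a) be
   the summand for m = k = 0.  Milne's identity sum_(|a| = r) T(a) = 1 / (t; t)_r
   holds for any base and any variables; with base p = q^kappa and variables
   q^(e_j), e = (0, ..., n-2, n-1+k), it expands into a sum with the same signs
   and exponents, but with another product B'(a o s^-1) in place of B(a).  For
   large r all exponents outside a region where every a_c is large become
   large, and in that region B and B' are close to constants.  So the ratio of
   the two sums tends to B'(oo) / B(oo), which gives the product side. *)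

Require Import Defs.
From mathcomp Require Import all_boot all_order all_fingroup all_algebra.
From mathcomp Require Import boolp generic_quotient.
From mathcomp Require Import ring lra zify.

Set Implicit Arguments.
Unset Strict Implicit.
Unset Printing Implicit Defensive.
Import Order.TTheory GRing.Theory Num.Theory.
Local Open Scope ring_scope.

(** * Lagrange interpolation *)

(** The summand of [E(a, s)] at [c] is [(n a_c + c)(kappa a_c + e_(s c)) - n kappa C(a_c + 1, 2)].
    It is unchanged when [(n, c)] and [(kappa, e_(s c))] trade places, and this duality is why two
    sums of different origin share their exponents. In [Q] the level [kappa] is [m + n], with [m]
    from the monomials and [n] from the powers inside [T], and the alternant in [e] is the numerator
    of the complete symmetric function [h_k] of the places open to the part [k]. In Milne's identity
    [kappa] comes from the base, and the alternant is a Vandermonde product. The bound [k <= m] puts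
    every [e_j] below [kappa], so they are distinct modulo [kappa] and no denominator vanishes. The
    obstacle: normalised exponents depend on [r] only through the [n a_c - r], whose possible values
    change with [r] modulo [n], so no limit can be taken term by term. Hence a constant multiple of
    Milne's sum is subtracted first, leaving the same terms with coefficients [1/B - const/B'].
    Normalised exponents may be negative, but they are bounded below uniformly in [r]. *)

Section Interpolation.
Variables (F : fieldType) (T : finType).
Implicit Types (A : {set T}) (y z : T -> F).

(** The difference [P] of the monic polynomials with roots [y] and [z] has degree below [#|A|], so
    it equals its Lagrange interpolant [L] at the nodes [z]. The identity is [P = L] evaluated at 0,
    divided by the product of the [- z i]. *)
Lemma lagrange_sum A y z :
  {in A &, injective z} -> (forall i, i \in A -> z i != 0) ->
  \sum_(i in A) (\prod_(j in A) (z i - y j)) /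
     (z i * \prod_(j in A :\ i) (z i - z j))
  = 1 - \prod_(j in A) (y j / z j).
Proof.
move=> z_inj z_neq0.
pose P : {poly F} := \prod_(j in A) ('X - (y j)%:P) - \prod_(j in A) ('X - (z j)%:P).
pose L : {poly F} := \sum_(i in A) (P.[z i] / \prod_(j in A :\ i) (z i - z j)) *:
   \prod_(j in A :\ i) ('X - (z j)%:P).
have sz1 (B : {set T}) (u : T -> F) : size (\prod_(j in B) ('X - (u j)%:P)) = #|B|.+1.
  rewrite size_prod; last by move=> i _; rewrite polyXsubC_eq0.
  under eq_bigr do rewrite size_XsubC.
  by rewrite sum_nat_const [(_ * _)%N]muln2 -addnn -addSn addnK.
have mon (B : {set T}) (u : T -> F) : \prod_(j in B) ('X - (u j)%:P) \is monic.
  by apply: monic_prod => i _; apply: monicXsubC.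
have szP : (size P <= #|A|)%N.
  apply/leq_sizeP => j; rewrite leq_eqVlt => /orP[/eqP <-|ltAj]; rewrite coefB.
    have /monicP := mon A y; have /monicP := mon A z.
    by rewrite !lead_coefE !sz1 /= => -> ->; rewrite subrr.
  by rewrite !nth_default ?subrr // sz1.
have szL : (size L <= #|A|)%N.
  apply: (leq_trans (size_sum _ _ _)); apply/bigmax_leqP => i iA.
  apply: (leq_trans (size_scale_leq _ _)); rewrite (sz1 (A :\ i)) /=.
  by rewrite (cardsD1 i A) iA.
have PL : P = L.
  apply/eqP; rewrite -subr_eq0; apply: contraT => nz.
  have szPL : (size (P - L)%R <= #|A|)%N.
    apply: (leq_trans (size_polyD _ _)); rewrite size_polyN geq_max szP szL //.
  have uz : uniq [seq z i | i in A].
    by rewrite map_inj_in_uniq ?enum_uniq // => i j; rewrite !mem_enum; apply: z_inj.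
  have rz : all (root (P - L)) [seq z i | i in A].
    apply/allP => x /mapP[i]; rewrite mem_enum => iA -> {x}.
    rewrite /root hornerD hornerN horner_sum (bigD1 i) //= [X in _ - (_ + X)]big1 ?addr0.
      rewrite hornerZ horner_prod.
      rewrite [X in _ - _ * X](eq_bigr (fun j => z i - z j)); last first.
        by move=> j _; rewrite hornerXsubC.
      rewrite divfK ?subrr //; apply/prodf_neq0 => j; rewrite !inE => /andP[ji jA].
      by rewrite subr_eq0; apply: contra ji => /eqP /z_inj ->.
    move=> j /andP[jA ji]; rewrite hornerZ horner_prod [X in _ * X](bigD1 i) /=.
      by rewrite hornerXsubC subrr mul0r mulr0.
    by rewrite !inE eq_sym ji.
  have := max_poly_roots nz rz uz; rewrite size_map -cardE => /leq_trans /(_ szPL).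
  by rewrite ltnn.
have := congr1 (fun p => p.[0]) PL.
rewrite /= hornerD hornerN !horner_prod horner_sum.
under eq_bigr do rewrite hornerXsubC sub0r.
under [X in _ - X]eq_bigr do rewrite hornerXsubC sub0r.
have zA0 : \prod_(j in A) z j != 0 by apply/prodf_neq0.
have Pz i : i \in A -> P.[z i] = \prod_(j in A) (z i - y j).
  move=> iA; rewrite hornerD hornerN !horner_prod [X in _ - X](bigD1 i) //=.
  rewrite hornerXsubC subrr mul0r subr0.
  by under eq_bigr do rewrite hornerXsubC.
rewrite !prodrN prodf_div => E.
apply: (mulfI zA0); rewrite mulrBr mulr1 mulrCA mulfV // mulr1.
have s0 : (-1) ^+ #|A| != 0 :> F by rewrite signr_eq0.
apply: (mulfI s0); rewrite [RHS]mulrBr.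
rewrite -(opprB (_ * \prod_(j in A) y j)) E.
rewrite !mulr_sumr -sumrN; apply: eq_bigr => i iA.
rewrite Pz // hornerZ horner_prod.
under [X in - (_ * X)]eq_bigr do rewrite hornerXsubC sub0r.
rewrite prodrN (big_setD1 i iA) /= (cardsD1 i A) iA exprS.
set D := \prod_(j in A :\ i) (z i - z j); set Y := \prod_(j in A) _.
have D0 : D != 0.
  apply/prodf_neq0 => j; rewrite !inE => /andP[ji jA].
  by rewrite subr_eq0; apply: contra ji => /eqP /z_inj ->.
by field; rewrite D0 z_neq0.
Qed.

End Interpolation.

(** * Symmetrisation over the symmetric group *)

Lemma qpochS (F : fieldType) (a p : F) k :
  qpoch a p k.+1 = qpoch a p k * (1 - a * p ^+ k).
Proof. by rewrite /qpoch big_nat_recr. Qed.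

(** The permutations with [w ord0 = i] are parametrised as in a cofactor expansion; [ulsf] deletes a
    point together with its image, which inverts the parametrisation. *)
Lemma sum_perm_lift (V : nmodType) N (G : 'S_N.+1 -> V) :
  \sum_w G w = \sum_i \sum_(s : 'S_N) G (lift_perm ord0 i s).
Proof.
rewrite (partition_big (fun w : 'S_N.+1 => w ord0) xpredT) //=.
apply: eq_bigr => i _; rewrite (reindex (lift_perm ord0 i)) /=.
  by apply: eq_bigl => s; rewrite lift_perm_id eqxx.
pose ulsf i (s : 'S_N.+1) k := odflt k (unlift (s i) (s (lift i k))).
have ulsfK l (s : 'S_N.+1) k : lift (s l) (ulsf l s k) = s (lift l k).
  rewrite /ulsf; have := neq_lift l k.
  by rewrite -(can_eq (permK s)) => /unlift_some[] ? ? ->.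
have inj_ulsf : injective (ulsf ord0 _).
  move=> s; apply: can_inj (ulsf (s ord0) s^-1%g) _ => k'.
  by rewrite {1}/ulsf ulsfK !permK liftK.
exists (fun s => perm (inj_ulsf s)) => [s _ | s].
  by apply/permP=> k'; rewrite permE /ulsf lift_perm_lift lift_perm_id liftK.
rewrite inE => /(_ =P _) si0; apply/permP=> k.
case: (unliftP ord0 k) => [k'|] ->; rewrite ?lift_perm_id //.
by rewrite lift_perm_lift -si0 permE ulsfK.
Qed.

Section Symmetrization.
Variables (F : fieldType) (T : finType) (x : T -> F) (t : F).
Implicit Types (A S : {set T}) (la : seq nat).
Hypotheses (x_inj : injective x) (x_neq0 : forall i, x i != 0).
Hypothesis t_neq1 : 1 - t != 0.

Definition hl_factor i j := (x i - t * x j) / (x i - x j).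
Definition tfact k := qpoch t t k / (1 - t) ^+ k.

Lemma tfactS k : tfact k.+1 = (1 - t ^+ k.+1) / (1 - t) * tfact k.
Proof.
rewrite /tfact qpochS !exprS; set q1 := qpoch _ _ _.
by field; rewrite expf_neq0 t_neq1.
Qed.

(** This is [lagrange_sum] with [y = t x]: the factor [j = i] of the numerator is [(1 - t) * x i],
    whence the division by [1 - t]. *)
Lemma hl_factor_sum A :
  \sum_(i in A) \prod_(j in A :\ i) hl_factor i j = (1 - t ^+ #|A|) / (1 - t).
Proof.
have := @lagrange_sum F T A (fun j => t * x j) x (in2W x_inj) (in1W x_neq0).
under [X in 1 - X]eq_bigr do rewrite mulfK //.
rewrite prodr_const => <-; rewrite mulr_suml; apply: eq_bigr => i iA.
rewrite prodf_div [in RHS](big_setD1 i iA) /=.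
set D := \prod_(j in _) (x i - x j).
have D0 : D != 0.
  by apply/prodf_neq0 => j; rewrite !inE subr_eq0 => /andP[ji _];
    apply: contra ji => /eqP /x_inj ->.
by field; rewrite t_neq1 D0 x_neq0.
Qed.

(** Symmetrisation over the orderings of [A], one position at a time: [i] is the entry at the
    current position. Positions beyond the end of [la] have exponent 0, and their symmetrised
    product is the [t]-factorial [tfact]. *)
Fixpoint hl_sum la A : F :=
  if la is l :: la' then
    \sum_(i in A) x i ^+ l * (\prod_(j in A :\ i) hl_factor i j) * hl_sum la' (A :\ i)
  else tfact #|A|.

(** Lets an exhausted list be read as a list with further parts 0, as the induction in [hl_sum_perm]
    requires. *)
Lemma hl_sum_nil A : 
  hl_sum [::] A = if #|A| is 0%N then 1 else
    \sum_(i in A) (\prod_(j in A :\ i) hl_factor i j) * hl_sum [::] (A :\ i).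
Proof.
case cA : #|A| => [|k] /=; first by rewrite cA /tfact /qpoch big_nil expr0 invr1 mulr1.
rewrite cA (eq_bigr (fun i => \prod_(j in A :\ i) hl_factor i j * tfact k)); last first.
  by move=> i iA; have := cardsD1 i A; rewrite iA cA => -[->].
by rewrite -mulr_suml hl_factor_sum tfactS cA.
Qed.

Lemma hl_sum_perm N (phi : 'I_N -> T) la : injective phi -> (size la <= N)%N ->
  \sum_(w : 'S_N)
      ((\prod_(i < N) x (phi (w i)) ^+ nth 0%N la i) *
       \prod_(i < N) \prod_(j < N | (i < j)%N) hl_factor (phi (w i)) (phi (w j)))
  = hl_sum la (phi @: setT).
Proof.
elim: N phi la => [|N IH] phi la phi_inj.
  rewrite leqn0 size_eq0 => /eqP ->; rewrite hl_sum_nil card_imset // cardsT card_ord.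
  rewrite (eq_bigr (fun=> 1)) => [|w _]; last by rewrite !big_ord0 mulr1.
  by rewrite sumr_const card_Sn.
have lift_inj' i : injective (phi \o lift i) by apply: inj_comp => //; apply: lift_inj.
have imD i : (phi \o lift i) @: setT = (phi @: setT) :\ phi i.
  apply/setP => j; rewrite !inE; apply/imsetP/andP.
    move=> [k _ ->] /=; rewrite imset_f // inj_eq //; split => //.
    by rewrite eq_sym neq_lift.
  move=> [ji /imsetP[k _ jk]]; move: ji; rewrite jk inj_eq // eq_sym => /unlift_some[k' kk' _].
  by exists k' => //=; rewrite -kk'.
have hd : hl_sum la (phi @: setT) = \sum_(i in phi @: setT) x i ^+ head 0%N la *
   (\prod_(j in (phi @: setT) :\ i) hl_factor i j) * hl_sum (behead la) ((phi @: setT) :\ i).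
  case: la => [|l la //]; rewrite hl_sum_nil card_imset // cardsT card_ord.
  by apply: eq_bigr => i _; rewrite expr0 mul1r.
move=> szla; rewrite {}hd big_imset /=; last by move=> i j _ _; apply: phi_inj.
rewrite sum_perm_lift; apply: eq_big => [i|i _]; first by rewrite inE.
rewrite -imD -IH //; last by case: la szla.
rewrite mulr_sumr; apply: eq_bigr => s _.
rewrite big_ord_recl lift_perm_id [X in _ * X = _]big_ord_recl.
rewrite -!mulrA; congr (_ * _).
rewrite mulrCA; congr (_ * _).
  rewrite big_imset /=; last by move=> k l _ _; apply: lift_inj'.
  rewrite big_mkcond big_ord_recl /= mul1r [in RHS](reindex_inj (@perm_inj _ s)) /=.
  apply: eq_big => [k|k _]; first by rewrite inE.
  by rewrite lift_perm_lift lift_perm_id.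
congr (_ * _).
  by apply: eq_bigr => k _; rewrite lift_perm_lift; case: la szla => //= _; rewrite !nth_nil.
apply: eq_bigr => k _; rewrite big_mkcond big_ord_recl /= mul1r [RHS]big_mkcond.
by apply: eq_bigr => l _; rewrite !lift_perm_lift.
Qed.

(** [S] is the set of entries in the first [r] positions. Their mutual order affects only the
    factors inside [S], and these sum to [tfact r] over all orders. *)
Lemma hl_sum_nseq r m la A :
  hl_sum (nseq r m ++ la) A = tfact r * \sum_(S : {set T} | (S \subset A) && (#|S| == r))
    (\prod_(i in S) x i ^+ m) * (\prod_(i in S) \prod_(j in A :\: S) hl_factor i j) *
    hl_sum la (A :\: S).
Proof.
elim: r A => [|r IH] A /=.
  rewrite (big_pred1 set0) => [|S]; last first.
    by rewrite cards_eq0 /= andbC; case: eqP => //= ->; rewrite sub0set.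
  by rewrite !big_set0 setD0 /tfact /qpoch big_nil expr0 invr1 !mul1r.
rewrite tfactS.
(* [hl_factor_sum] reopens [(1 - t ^+ r.+1) / (1 - t)] as a sum over the element [i] of [S] that
   comes first; the induction hypothesis then concerns [S :\ i]. *)
transitivity (tfact r * \sum_(S : {set T} | (S \subset A) && (#|S| == r.+1))
   \sum_(i in S) (\prod_(j in S :\ i) hl_factor i j) *
    ((\prod_(i in S) x i ^+ m) * (\prod_(i in S) \prod_(j in A :\: S) hl_factor i j) *
    hl_sum la (A :\: S))); last first.
  rewrite -[RHS]mulrA [RHS]mulrCA; congr (_ * _); rewrite mulr_sumr.
  apply: eq_bigr => S /andP[_ /eqP cS].
  by rewrite -mulr_suml hl_factor_sum cS.
rewrite (exchange_big_dep (mem A)) /=; last first.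
  by move=> S i /andP[/subsetP SA _] /SA.
rewrite mulr_sumr; apply: eq_bigr => i iA.
rewrite IH [in LHS]mulrCA; congr (_ * _); rewrite mulr_sumr.
rewrite (reindex_onto (fun S => S :\ i) (fun S => i |: S)) /=; last first.
  by move=> S /andP[/subsetP SA _]; rewrite setU1K //; apply/negP => /SA; rewrite !inE eqxx.
apply: eq_big => [S|S].
  case iS : (i \in S); last first.
    rewrite andbF; apply/negbTE; apply: contraFN iS => /andP[_ /eqP <-].
    by rewrite !inE eqxx.
  rewrite setD1K // eqxx !andbT; have := cardsD1 i S; rewrite iS add1n => ->; rewrite eqSS.
  by congr (_ && _); rewrite subDset setD1K.
move=> /andP[/andP[SA _] /eqP Si]; have iS : i \in S by rewrite -Si !inE eqxx.
have AS : (A :\ i) :\: (S :\ i) = A :\: S.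
  by apply/setP => j; rewrite !inE; case: (eqVneq j i) => //= ->; rewrite iS.
rewrite AS.
have -> : \prod_(j in A :\ i) hl_factor i j =
   (\prod_(j in S :\ i) hl_factor i j) * \prod_(j in A :\: S) hl_factor i j.
  rewrite (big_setID (S :\ i)) /= AS; congr (_ * _); apply: eq_bigl => j.
  have /subsetP/(_ j) := SA; rewrite !inE.
  by case: (j \in S); case: (j == i); case: (j \in A) => //= H; have := H isT.
rewrite [X in _ = _ * (X * _ * _)](big_setD1 i iS) [X in _ = _ * (_ * X * _)](big_setD1 i iS) /=.
by ring.
Qed.

Lemma hl_sum_nseq1 r m k A :
  hl_sum (nseq r m ++ [:: k]) A = tfact r * tfact (#|A| - r.+1) *
   \sum_(S : {set T} | (S \subset A) && (#|S| == r))
    (\prod_(i in S) x i ^+ m) * (\prod_(i in S) \prod_(j in A :\: S) hl_factor i j) *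
    \sum_(s in A :\: S) x s ^+ k * \prod_(j in A :\: S :\ s) hl_factor s j.
Proof.
rewrite hl_sum_nseq -[RHS]mulrA; congr (_ * _); rewrite mulr_sumr; apply: eq_bigr => S /andP[SA /eqP cS].
rewrite mulrCA; congr (_ * _); rewrite /= mulr_sumr; apply: eq_bigr => s sAS.
have := cardsD1 s (A :\: S); rewrite sAS cardsDS // cS => E.
have -> : #|A :\: S :\ s| = (#|A| - r.+1)%N by lia.
by rewrite mulrC.
Qed.

End Symmetrization.

(** * Sets of exponents closed under subtraction of n *)

Lemma sum_count_mem la :
  (\sum_(1 <= i < (\max_(p <- la) p).+1) count_mem i la)%N = plength la.
Proof.
rewrite /plength; move: (\max_(p <- la) p) (@leq_bigmax_seq _ la xpredT id) => B leB.
have {}leB : {in la, forall p, p <= B}%N by move=> p pla; apply: leB.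
elim: la leB => [|p la IH] leB /=; first by rewrite big1.
rewrite big_split /= IH => [|i ila]; last by apply: leB; rewrite inE ila orbT.
congr (_ + _)%N; have pB : (p <= B)%N by apply: leB; rewrite inE eqxx.
rewrite big_add1 /= big_mkord; case: p pB {leB} => [|p] pB; first by rewrite big1.
rewrite (bigD1 (Ordinal pB)) //= eqxx big1 ?addn0 // => i.
by rewrite -val_eqE /= eqSS eq_sym => /negbTE ->.
Qed.

(** [hl_b] cancels the Pochhammer symbols of [hl_v] for all [i >= 1], so only that of [m_0]
    survives; all multiplicities, [m_0] included, add up to [N], which gives the power of
    [1 - t]. *)
Lemma hl_bv (F : fieldType) (la : seq nat) (t : F) N :
  (forall j, 1 - t * t ^+ j != 0) -> 1 - t != 0 -> (plength la <= N)%N ->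
  hl_b la t * (hl_v la t N)^-1 = (1 - t) ^+ N / qpoch t t (N - plength la).
Proof.
move=> t_pow t1 laN.
have qp0 j : qpoch t t j != 0 by rewrite /qpoch big_mkord; apply/prodf_neq0.
rewrite /hl_v /hl_b [X in _ / X]big_nat_recl //= big_add1 /= invfM mulrCA -prodfV -big_split /=.
rewrite (eq_big_nat _ _ (F2 := fun i => (1 - t) ^+ count_mem i.+1 la)); last first.
  by move=> i _; field; rewrite qp0 expf_neq0.
rewrite big_mkord prodrXr -(big_mkord xpredT (fun i => count_mem i.+1 la)).
have := sum_count_mem la; rewrite big_add1 /= => ->.
rewrite invfM invrK -mulrA -exprD subnK // mulrC //.
Qed.

Section Classes.
Variable n' : nat.
Local Notation n := n'.+1.
Implicit Types (a : 'I_n -> nat).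

(* [inS a] is the set of all c + n l with l < a c, and [corner a c] is the least
   element of the class of c outside it. *)
Definition cls j : 'I_n := Ordinal (ltn_pmod j (ltn0Sn n')).
Definition inS a j := (j %/ n < a (cls j))%N.
Definition node (c : 'I_n) l := (c + n * l)%N.
Definition corner a c := node c (a c).

Lemma node_div (c : 'I_n) l : (node c l %/ n = l)%N.
Proof. by rewrite /node addnC mulnC divnMDl // divn_small ?addn0 ?ltn_ord. Qed.

Lemma node_cls (c : 'I_n) l : cls (node c l) = c.
Proof. by apply: val_inj; rewrite /= /node addnC mulnC modnMDl modn_small ?ltn_ord. Qed.

Lemma cls_node j : node (cls j) (j %/ n) = j.
Proof. by rewrite /node /= {3}(divn_eq j n) addnC mulnC. Qed.

Lemma node_inj c l c2 l2 : node c l = node c2 l2 -> c = c2 /\ l = l2.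
Proof.
by move=> E; have := congr1 cls E; have := congr1 (fun j => j %/ n)%N E; rewrite !node_cls !node_div.
Qed.

Lemma inS_node a c l : inS a (node c l) = (l < a c)%N.
Proof. by rewrite /inS node_div node_cls. Qed.

Lemma big_nodes (R : Type) (idx : R) (op : Monoid.com_law idx) M (G : nat -> R) :
  \big[op/idx]_(0 <= j < n * M) G j =
  \big[op/idx]_(c < n) \big[op/idx]_(0 <= l < M) G (node c l).
Proof.
elim: M => [|M IH]; first by rewrite muln0 big_nil big1 // => c _; rewrite big_nil.
rewrite mulnS addnC (big_cat_nat (n := (n * M)%N)) ?leq_addr //= {}IH.
have -> : \big[op/idx]_(n * M <= j < n * M + n) G j = \big[op/idx]_(c < n) G (node c M).
  by rewrite -{1}[(n * M)%N]add0n big_addn addKn big_mkord.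
rewrite -big_split /=.
by apply: eq_bigr => c _; rewrite big_nat_recr //=.
Qed.

Lemma big_inS (R : Type) (idx : R) (op : Monoid.com_law idx) N a (G : nat -> R) :
  (forall j, inS a j -> j < N)%N ->
  \big[op/idx]_(0 <= j < N | inS a j) G j =
  \big[op/idx]_(c < n) \big[op/idx]_(0 <= l < a c) G (node c l).
Proof.
move=> aN; rewrite (big_nat_widen _ _ (n * N)) ?leq_pmull //.
rewrite (eq_bigl (inS a)) => [|j]; last by case aj: (inS a j); rewrite ?(aN _ aj).
rewrite big_mkcond big_nodes; apply: eq_bigr => c _; rewrite -big_mkcond.
have acN : (a c <= N)%N.
  rewrite leqNgt; apply/negP => Na; have := aN (node c N); rewrite inS_node Na /node.
  by move=> /(_ isT); lia.
by rewrite [RHS](big_nat_widen _ _ N) //; apply: eq_bigl => l; rewrite inS_node.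
Qed.

Definition Sa N a := [set i : 'I_N | inS a i].

Lemma card_Sa N a : (forall j, inS a j -> j < N)%N -> #|Sa N a| = (\sum_c a c)%N.
Proof.
move=> aN; rewrite -sum1_card; under eq_bigl do rewrite inE.
rewrite -(big_mkord (inS a) (fun=> 1%N)) big_inS //.
by apply: eq_bigr => c _; rewrite sum_nat_const_nat subn0 muln1.
Qed.

Lemma inS_lt a M N : (forall c, a c <= M)%N -> (n * M <= N)%N ->
  forall j, (inS a j -> j < N)%N.
Proof.
move=> aM MN j; rewrite -(cls_node j) inS_node => /leq_trans/(_ (aM _)).
rewrite /node; move: (j %/ n)%N (cls j) => l c lM; have := ltn_ord c; nia.
Qed.

Definition weak_comp B r (b : {ffun 'I_n -> 'I_B}) := (\sum_c b c == r)%N.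

(** A set with [Phi S != 0] is closed under subtraction of [n], hence an initial segment of each
    residue class, and is recovered from the lengths of these segments. No length exceeds [r], so
    the index type ['I_r.+1] loses nothing. *)
Lemma closed_sum (V : nmodType) N r (Phi : {set 'I_N} -> V) : (n * r <= N)%N ->
  (forall (S : {set 'I_N}) (i j : 'I_N), i \in S -> j \notin S -> i = (j + n)%N :> nat ->
     Phi S = 0) ->
  \sum_(S : {set 'I_N} | #|S| == r) Phi S =
  \sum_(a : {ffun 'I_n -> 'I_r.+1} | weak_comp r a) Phi (Sa N (fun c => a c)).
Proof.
move=> rN Phi0; pose h (a : {ffun 'I_n -> 'I_r.+1}) := Sa N (fun c => a c).
have aS (a : {ffun 'I_n -> 'I_r.+1}) j : (inS (fun c => a c) j -> j < N)%N.
  by apply: (inS_lt (M := r)) => // c; rewrite -ltnS.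
have h_inj : {in [set a : {ffun 'I_n -> 'I_r.+1} | weak_comp r a] &, injective h}.
  move=> a b _ _ /setP hab; apply/ffunP => c; apply: val_inj.
  have lt_iff l : (l < a c)%N = (l < b c)%N.
    have := hab; rewrite /h => H.
    case: (ltnP (node c l) N) => [lN|Nl].
      by have := H (Ordinal lN); rewrite !inE /= !inS_node.
    apply/idP/idP => lt; [have := aS a (node c l)|have := aS b (node c l)];
      by rewrite inS_node lt => /(_ isT); rewrite ltnNge Nl.
  have := lt_iff (a c); have := lt_iff (b c); rewrite !ltnn; by case: ltngtP.
transitivity (\sum_(S in h @: [set a : {ffun 'I_n -> 'I_r.+1} | weak_comp r a]) Phi S); last first.
  by rewrite big_imset //=; apply: eq_bigl => a; rewrite inE.
rewrite [RHS]big_mkcond [LHS]big_mkcond; apply: eq_bigr => S _.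
case: ifP => [/eqP cS|cS]; last first.
  case: ifP => // /imsetP[a]; rewrite inE => /eqP Ea hS.
  by move: cS; rewrite hS card_Sa ?Ea ?eqxx //; apply: aS.
case: ifP => // SI; apply/eqP; apply: contraFT SI => PS.
have Scl (i j : 'I_N) : i \in S -> i = (j + n)%N :> nat -> j \in S.
  by move=> iS ij; apply: contraR PS => jS; rewrite (Phi0 S i j).
pose inSn j := (if insub j is Some i then i \in S else false).
have exl (c : 'I_n) : exists l, ~~ inSn (node c l).
  by exists N; rewrite /inSn insubF //; apply/negbTE; rewrite -leqNgt /node; lia.
(* The least level missing from [S] in the class of [c]; by closure every higher level is missing
   too. *)
pose b c := ex_minn (exl c).
have cl j l : inSn (j + n * l)%N -> inSn j.
  elim: l => [|l IH]; first by rewrite muln0 addn0.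
  rewrite {1}/inSn; case: insubP => // i ltN iE iS; apply: IH; rewrite /inSn.
  have ltj : (j + n * l < N)%N by move: ltN; rewrite mulnS; lia.
  by rewrite insubT; apply: (Scl i) => //=; rewrite [LHS]iE mulnS; lia.
have SE (i : 'I_N) : (i \in S) = inS b i.
  have iE : inSn i = (i \in S) by rewrite /inSn valK.
  rewrite -iE -{2}(cls_node i) inS_node /b; case: ex_minnP => l nl minl.
  case: ltnP => [ltl|lel].
    by apply: contraLR ltl => ni; rewrite -leqNgt; apply: minl; rewrite cls_node.
  apply/negbTE; apply: contra nl => iS.
  apply: (cl _ (i %/ n - l)%N); rewrite [X in inSn X](_ : _ = i :> nat) //.
  rewrite -[in RHS](cls_node i) /node -addnA -mulnDr; congr (_ + n * _)%N; lia.
have bN j : (inS b j -> j < N)%N.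
  rewrite -{1}(cls_node j) inS_node /b; case: ex_minnP => l nl minl ltl.
  rewrite ltnNge; apply/negP => Nj; have := minl (j %/ n)%N.
  by rewrite cls_node /inSn insubF ?ltnNge ?Nj //= => /(_ isT); rewrite leqNgt ltl.
have Sb : S = Sa N b by apply/setP => i; rewrite inE SE.
have sumb : (\sum_c b c = r)%N by rewrite -(card_Sa bN) -Sb.
have br c : (b c < r.+1)%N by rewrite ltnS -sumb (bigD1 c) //= leq_addr.
apply/imsetP; exists [ffun c => Ordinal (br c)].
  by rewrite inE /weak_comp; under eq_bigr do rewrite ffunE; rewrite /= sumb.
by rewrite Sb; apply/setP => i; rewrite !inE /inS ffunE.
Qed.

Definition incr a (c0 : 'I_n) : 'I_n -> nat := fun c => (a c + (c == c0))%N.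

Lemma inS_incr a c0 j : inS (incr a c0) j = inS a j || (j == corner a c0).
Proof.
rewrite /inS /incr /corner -{6}(cls_node j).
case: (eqVneq (cls j) c0) => [->|ne] /=; last first.
  rewrite addn0; case: eqP => [/node_inj[E _]|]; first by rewrite E eqxx in ne.
  by rewrite orbF.
rewrite addn1 ltnS leq_eqVlt orbC; congr (_ || _).
by apply/eqP/eqP => [->|/node_inj[]].
Qed.

End Classes.

(** * Evaluation of Q at finitely many powers of q *)

Section PrincipalSpecialisation.
Variables (F : fieldType) (q0 : F) (n' : nat).
Local Notation n := n'.+1.
Hypothesis q0_inj : injective (fun i : nat => q0 ^+ i).
Implicit Types (a : 'I_n -> nat).

Local Lemma q0_neq0 : q0 != 0.
Proof.
apply/eqP => q00; have : 1%N = 2%N by apply: q0_inj; rewrite /= q00 !expr0n.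
by [].
Qed.

Lemma qpow_neq i j : i != j -> q0 ^+ i - q0 ^+ j != 0.
Proof. by apply: contra; rewrite subr_eq0 => /eqP /q0_inj ->. Qed.

Lemma qpow_neq1 j : (0 < j)%N -> 1 - q0 ^+ j != 0.
Proof. by move=> j0; rewrite -(expr0 q0) qpow_neq // eq_sym -lt0n. Qed.

(** Multiplication by [q0 ^+ n] leads to the next node of the same class, so each class telescopes
    from its corner to its first node at or beyond [N]. These end nodes are [N, ..., N + n - 1]. *)
Lemma prod_notin a M N (v : F) : (forall c, a c <= M)%N -> (n * M <= N)%N ->
  (forall j, ~~ inS a j -> v - q0 ^+ j != 0) ->
  \prod_(0 <= j < N | ~~ inS a j) ((v - q0 ^+ n * q0 ^+ j) / (v - q0 ^+ j)) =
  \prod_(l < n) (v - q0 ^+ (N + l)) / \prod_c (v - q0 ^+ corner a c).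
Proof.
move=> aM MN vj; rewrite -(subnKC MN); elim: (N - _)%N => [|d IH]; last first.
  rewrite addnS big_mkcond big_nat_recr ?leq_addr // -big_mkcond /= {}IH.
  have nS l : (n * M + d <= l)%N -> ~~ inS a l.
    by move=> Ml; apply/negP => /(inS_lt aM (leqnn _)); lia.
  rewrite nS // big_ord_recl [in RHS]big_ord_recr /= !addn0.
  rewrite (eq_bigr (fun i : 'I_n' => v - q0 ^+ ((n * M + d).+1 + i))) => [|i _]; last first.
    by rewrite /bump /= add1n addnS.
  rewrite -exprD (_ : n + (n * M + d) = (n * M + d).+1 + n')%N; last by lia.
  have v0 := vj _ (nS _ (leqnn _)).
  have c0 : \prod_c (v - q0 ^+ corner a c) != 0.
    by apply/prodf_neq0 => c _; apply: vj; rewrite inS_node ltnn.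
  by field; rewrite v0 c0.
rewrite addn0 big_mkcond big_nodes -prodf_div; apply: eq_bigr => c _.
rewrite -big_mkcond (eq_bigl (fun l => true && (a c <= l)%N)) => [|l]; last first.
  by rewrite inS_node -leqNgt.
rewrite -big_nat_widenl // (eq_bigr (fun l =>
   (v - q0 ^+ node c l.+1) / (v - q0 ^+ node c l))) => [|l _]; last first.
  by rewrite -exprD /node mulnS addnCA.
have vl l : (a c <= l)%N -> v - q0 ^+ node c l != 0.
  by move=> al; apply: vj; rewrite inS_node -leqNgt.
have := aM c; rewrite leq_eqVlt => /orP[/eqP acM|ltM].
  rewrite big_geq ?acM // /corner acM /node addnC divff //.
  by have := vl M; rewrite acM leqnn /node addnC => ->.
rewrite telescope_prodf // => [|l /andP[/ltnW al _]]; last exact: vl.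
by rewrite /node [(c + n * M)%N]addnC.
Qed.

(** The contribution of the first [r] entries once the products over the complement have telescoped;
    [N] is left only in the powers [q0 ^+ (N + i)], which tend to 0 for [q0 = q]. *)
Definition row_term a m N : F :=
  \prod_c \prod_(0 <= l < a c)
    (q0 ^+ (m * node c l) * (\prod_(i < n) (q0 ^+ node c l - q0 ^+ (N + i)) /
      \prod_c' (q0 ^+ node c l - q0 ^+ corner a c'))).

Definition last_term a k N : F :=
  \sum_c0 q0 ^+ (k * corner a c0) *
     (\prod_(i < n) (q0 ^+ corner a c0 - q0 ^+ (N + i)) /
      \prod_c' (q0 ^+ corner a c0 - q0 ^+ corner (incr a c0) c')).

Local Notation t := (q0 ^+ n).
Local Notation x N := (fun i : 'I_N => q0 ^+ i).

Lemma hl_factor_eq0 N (i j : 'I_N) : i = (j + n)%N :> nat -> hl_factor (x N) t i j = 0.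
Proof. by move=> ij; rewrite /hl_factor ij -exprD addnC subrr mul0r. Qed.

Lemma prod_row a m M N : (forall c, a c <= M)%N -> (n * M <= N)%N ->
  (\prod_(i in Sa N a) x N i ^+ m) *
  (\prod_(i in Sa N a) \prod_(j in setT :\: Sa N a) hl_factor (x N) t i j) =
  row_term a m N.
Proof.
move=> aM MN; have aN := inS_lt aM MN.
rewrite -big_split /= /row_term.
under eq_bigl do rewrite inE.
rewrite (eq_bigr (fun i : 'I_N => q0 ^+ (m * i) * (\prod_(l < n) (q0 ^+ i - q0 ^+ (N + l)) /
      \prod_c' (q0 ^+ i - q0 ^+ corner a c')))) => [|i iS].
  by rewrite -(big_mkord (inS a) (fun i => q0 ^+ (m * i) *
     (\prod_(l < n) (q0 ^+ i - q0 ^+ (N + l)) /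
      \prod_c' (q0 ^+ i - q0 ^+ corner a c')))) big_inS.
rewrite -exprM mulnC -(prod_notin aM MN) => [|j nj]; last first.
  by apply: qpow_neq; apply: contraNneq nj => <-.
rewrite big_mkord; congr (_ * _); apply: eq_bigl => j.
by rewrite !inE andbT.
Qed.

Lemma sum_last a k M N : (forall c, a c < M)%N -> (n * M <= N)%N ->
  \sum_(s in setT :\: Sa N a) x N s ^+ k *
     \prod_(j in (setT :\: Sa N a) :\ s) hl_factor (x N) t s j =
  last_term a k N.
Proof.
move=> aM MN.
have lt c : (corner a c < N)%N.
  by rewrite /corner /node; have := aM c; have := ltn_ord c; move: (a c) => l; nia.
pose h c := Ordinal (lt c).
have h_inj : injective h by move=> c d /(congr1 val) /= /node_inj[].
transitivity (\sum_(s in h @: setT) x N s ^+ k *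
     \prod_(j in (setT :\: Sa N a) :\ s) hl_factor (x N) t s j).
  rewrite [LHS]big_mkcond [RHS]big_mkcond; apply: eq_bigr => s _.
  rewrite !inE andbT; case: (boolP (s \in h @: setT)) => [/imsetP[c _ ->]|sh].
    by rewrite /= inS_node ltnn.
  case: ifP => // nS.
  have ac : (a (cls n' s) < s %/ n)%N.
    rewrite ltn_neqAle leqNgt [X in _ && X]nS andbT.
    apply: contra sh => /eqP E; apply/imsetP; exists (cls n' s) => //.
    by apply: val_inj; rewrite /= /corner E cls_node.
  have sE := cls_node n' s.
  have ltN : (s - n < N)%N by have := ltn_ord s; lia.
  have ns : (n <= s)%N by rewrite -sE /node; move: (cls n' s) (s %/ n)%N ac => c l; nia.
  rewrite (bigD1 (Ordinal ltN)) /=.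
    by rewrite hl_factor_eq0 ?mul0r ?mulr0 //= subnK.
  rewrite !inE -val_eqE /= andbT; apply/andP; split; first by lia.
  have -> : (s - n = node (cls n' s) (s %/ n).-1)%N.
    by rewrite -{1}sE /node; move: (cls n' s) (s %/ n)%N ac => c l; nia.
  by rewrite inS_node -leqNgt; lia.
rewrite big_imset /=; last by move=> c d _ _; apply: h_inj.
apply: eq_big => [c|c _]; first by rewrite inE.
rewrite -exprM mulnC -(@prod_notin (incr a c) M) // => [|d|j].
- rewrite big_mkord; congr (_ * _); apply: eq_bigl => j.
  by rewrite !inE andbT inS_incr negb_or andbC -val_eqE.
- by rewrite /incr; have := aM d; case: eqP => _ /=; lia.
by rewrite inS_incr negb_or => /andP[_]; rewrite eq_sym; apply: qpow_neq.
Qed.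

Lemma near_rect_nth m r k i :
  nth 0%N (near_rect m r k) i = nth 0%N (nseq r m ++ [:: k]) i.
Proof.
case: k => [|k] //; rewrite /near_rect cats0 nth_cat size_nseq.
by case: ltnP => // ri; rewrite nth_nseq ltnNge ri /=; case: (i - r)%N => //= j; rewrite nth_nil.
Qed.

Lemma near_rect_length m r k : (0 < m)%N -> plength (near_rect m r k) = (r + (0 < k))%N.
Proof.
move=> m0; rewrite /plength /near_rect count_cat count_nseq [ltn 0 m]m0 mul1n.
by case: k => //= k; rewrite addn0.
Qed.

(** The symmetrisation uses the list with [k] appended even for [k = 0], whereas [hl_v] counts
    positive parts only. The quotient of two Pochhammer symbols corrects for this. *)
Lemma hl_Q_near_rect m r k N : (0 < m)%N -> (n * r.+1 <= N)%N ->
  hl_Q (near_rect m r k) t (x N) =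
  (1 - t) * qpoch t t r * (qpoch t t (N - r.+1) / qpoch t t (N - (r + (0 < k)))) *
  \sum_(a : {ffun 'I_n -> 'I_r.+1} | weak_comp r a)
     row_term (fun c => a c) m N * last_term (fun c => a c) k N.
Proof.
move=> m0 rN; have lerN : (r.+1 <= N)%N by apply: leq_trans rN; rewrite leq_pmull.
have t_pow j : 1 - t * t ^+ j != 0 by rewrite -exprS -exprM qpow_neq1 // muln_gt0.
have t1 : 1 - t != 0 by rewrite qpow_neq1.
have x_inj : injective (x N) by move=> i j /q0_inj /val_inj.
have x0 i : x N i != 0 by rewrite expf_neq0 ?q0_neq0.
have lN : (plength (near_rect m r k) <= N)%N.
  by rewrite near_rect_length //; case: k => /=; lia.
rewrite /hl_Q /hl_P lN mulrA hl_bv // near_rect_length //.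
have := hl_sum_perm x_inj x0 t1 (@inj_id 'I_N) (la := nseq r m ++ [:: k]).
rewrite size_cat size_nseq addn1 => /(_ lerN).
rewrite imset_id hl_sum_nseq1 // cardsT card_ord => E.
have {E} -> : \sum_(w : 'S_N) ((\prod_(i < N) x N (w i) ^+ nth 0%N (near_rect m r k) i) *
       \prod_(i < N) \prod_(j < N | (i < j)%N)
         ((x N (w i) - t * x N (w j)) / (x N (w i) - x N (w j)))) = 
   tfact t r * tfact t (N - r.+1) * \sum_(a : {ffun 'I_n -> 'I_r.+1} | weak_comp r a)
     row_term (fun c => a c) m N * last_term (fun c => a c) k N.
  transitivity (tfact t r * tfact t (N - r.+1) * \sum_(S : {set 'I_N} | #|S| == r)
    (\prod_(i in S) x N i ^+ m) * (\prod_(i in S) \prod_(j in setT :\: S) hl_factor (x N) t i j) *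
    \sum_(s in setT :\: S) x N s ^+ k * \prod_(j in setT :\: S :\ s) hl_factor (x N) t s j).
    rewrite [X in _ * X](eq_bigl (fun S : {set 'I_N} => (S \subset setT) && (#|S| == r))) => [|S].
      apply: etrans E.
      by apply: eq_bigr => w _; under eq_bigr do rewrite near_rect_nth.
    by rewrite subsetT.
  congr (_ * _); rewrite (@closed_sum n' _ _ r).
  - apply: eq_bigr => a _; rewrite (prod_row _ (M := r)) ?(sum_last _ (M := r.+1)) //.
      by move=> c; rewrite -ltnS.
    by apply: leq_trans rN; rewrite leq_mul2l leqnSn orbT.
  - by apply: leq_trans rN; rewrite leq_mul2l leqnSn orbT.
  move=> S i j iS jS ij; rewrite (bigD1 i iS) [X in _ * X * _](bigD1 i iS) /=.
  by rewrite [X in _ * (X * _) * _](bigD1 j) ?inE ?jS //= (hl_factor_eq0 ij) !mul0r mulr0 mul0r.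
rewrite !mulrA; congr (_ * _).
rewrite /tfact -{1}(subnKC lerN) exprD exprS.
have qp0 j : qpoch t t j != 0 by rewrite /qpoch big_mkord; apply/prodf_neq0.
by field; rewrite qp0 !expf_neq0.
Qed.

End PrincipalSpecialisation.

(** * Pairwise factorisation of the limiting terms *)

Lemma prod_pairs (R : comPzRingType) n (g : 'I_n -> 'I_n -> R) :
  \prod_i \prod_j g i j =
  (\prod_i g i i) * \prod_(i < n) \prod_(j < n | (i < j)%N) (g i j * g j i).
Proof.
rewrite (eq_bigr (fun i => g i i * ((\prod_(j < n | (i < j)%N) g i j) *
   \prod_(j < n | (j < i)%N) g i j))) => [|i _]; last first.
  rewrite (bigD1 i) //= (bigID (fun j : 'I_n => (i < j)%N)) /=; congr (_ * (_ * _)).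
    by apply: eq_bigl => j; rewrite -val_eqE /=; lia.
  by apply: eq_bigl => j; rewrite -val_eqE /=; lia.
rewrite !big_split /=; congr (_ * _).
rewrite [X in _ * X](exchange_big_dep xpredT) //= -big_split /=.
by apply: eq_bigr => i _; rewrite big_split.
Qed.

Lemma bin2D x y : 'C(x + y, 2) = ('C(x, 2) + 'C(y, 2) + x * y)%N.
Proof.
by elim: x => [|x IH]; rewrite ?addn0 // addSn !binS !bin1 IH mulSn; lia.
Qed.

Lemma bin2_big_sum n (a : 'I_n -> nat) :
  ('C(\sum_i a i, 2) =
   \sum_i 'C(a i, 2) + \sum_(i < n) \sum_(j < n | i < j) a i * a j)%N.
Proof.
elim: n a => [|n IH] a; first by rewrite !big_ord0.
rewrite !big_ord_recl /= bin2D (IH (fun i => a (lift ord0 i))).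
rewrite [(\sum_(i < n.+1 | _) _)%N]big_mkcond big_ord_recl /= add0n -big_distrr /=.
rewrite [X in (_ = _ + (_ + X))%N](eq_bigr (fun i : 'I_n =>
  \sum_(j < n | i < j) a (lift ord0 i) * a (lift ord0 j))%N) => [|i _].
  by rewrite -!addnA; congr (_ + (_ + _))%N; rewrite addnC.
by rewrite big_mkcond big_ord_recl /= add0n [RHS]big_mkcond.
Qed.

Section Pairs.
Variables (F : fieldType) (t : F).

(** Both sides are the product of [Y * t ^+ l - t * u] over [l <= b]; on the right, [t] is taken out
    of every factor but the first. *)
Lemma shift_prod (Y u : F) b :
  (\prod_(0 <= l < b) (Y * t ^+ l - t * u)) * (Y * t ^+ b - t * u) =
  (Y - t * u) * t ^+ b * \prod_(0 <= l < b) (Y * t ^+ l - u).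
Proof.
elim: b => [|b IH]; first by rewrite !big_nil !expr0 !mulr1 mul1r.
rewrite !big_nat_recr //= IH !exprS; ring.
Qed.

Hypothesis t_neq0 : t != 0.

Lemma diag_term (X : F) a : X != 0 -> (forall j, 1 - t * t ^+ j != 0) ->
  \prod_(0 <= l < a) (X * t ^+ l / (X * t ^+ l - X * t ^+ a)) = (qpoch t t a)^-1.
Proof.
move=> X0 tj.
rewrite (eq_bigr (fun l => t ^+ l / (t ^+ l - t ^+ a))) => [|l _]; last first.
  by rewrite -mulrBr invfM mulrACA mulfV // mul1r.
rewrite prodf_div prodrXr.
suff -> : \prod_(0 <= l < a) (t ^+ l - t ^+ a) =
   t ^+ (\sum_(0 <= l < a) l) * qpoch t t a.
  by rewrite invfM mulrA mulfV ?mul1r // expf_neq0.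
elim: a => [|a IH]; first by rewrite !big_nil /qpoch big_nil mulr1.
have E : (\prod_(0 <= l < a) (t ^+ l - t ^+ a.+1)) * (t ^+ a - t ^+ a.+1) =
    (1 - t ^+ a.+1) * t ^+ a * \prod_(0 <= l < a) (t ^+ l - t ^+ a).
  have := shift_prod 1 (t ^+ a) a; rewrite mul1r -exprS.
  rewrite (eq_bigr (fun l => t ^+ l - t ^+ a.+1)) => [->|l _]; last by rewrite mul1r.
  by congr (_ * _); apply: eq_bigr => l _; rewrite mul1r.
rewrite big_nat_recr //= E IH qpochS [in RHS]big_nat_recr //= exprD !exprS; ring.
Qed.

(** Separates the factors belonging to two classes into Pochhammer denominators, one Vandermonde
    factor and a monomial. Raising [a] shifts all denominators of the product over [b], and
    [shift_prod] evaluates the shift. *)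
Lemma pair_term (X Y : F) a b : X != 0 -> Y != 0 ->
  (forall i j, X * t ^+ i - Y * t ^+ j != 0) ->
  \prod_(0 <= l < b) (Y * t ^+ l / (Y * t ^+ l - X * t ^+ a)) *
  \prod_(0 <= l < a) (X * t ^+ l / (X * t ^+ l - Y * t ^+ b)) =
  (qpoch (t * X / Y) t a * qpoch (t * Y / X) t b)^-1 *
  ((X * t ^+ a - Y * t ^+ b) / (X - Y)) *
  (((- X) ^+ a / X ^+ b * t ^+ 'C(a, 2)) * ((- Y) ^+ b / Y ^+ a * t ^+ 'C(b, 2))) /
  t ^+ (a * b).
Proof.
move=> X0 Y0 XY.
have YX i j : Y * t ^+ j - X * t ^+ i != 0 by rewrite -opprB oppr_eq0.
have qXY j : 1 - t * X / Y * t ^+ j != 0.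
  have := XY j.+1 0%N; apply: contra => /eqP E; rewrite expr0 exprS.
  rewrite (_ : _ - _ = - (Y * (1 - t * X / Y * t ^+ j))); last by field.
  by rewrite E mulr0 oppr0.
have qYX j : 1 - t * Y / X * t ^+ j != 0.
  have := YX 0%N j.+1; apply: contra => /eqP E; rewrite expr0 exprS.
  rewrite (_ : _ - _ = - (X * (1 - t * Y / X * t ^+ j))); last by field.
  by rewrite E mulr0 oppr0.
have q0 (u : F) j : (forall i, 1 - u * t ^+ i != 0) -> qpoch u t j != 0.
  by move=> uj; rewrite /qpoch big_mkord; apply/prodf_neq0.
have XY1 : X - Y != 0 by have := XY 0%N 0%N; rewrite !expr0 !mulr1.
elim: a => [|a IH].
  rewrite big_nil mulr1 mul0n !expr0 divr1 /=.
  elim: b => [|b IH].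
    rewrite big_nil /qpoch !big_nil !expr0 !mulr1. by rewrite divff ?invr1 ?mulr1.
  rewrite big_nat_recr //= IH !qpochS [in RHS]binS bin1.
  have := XY 0%N b; have := YX 0%N b; have := qYX b; have := q0 _ b qYX.
  have tb : t ^+ b != 0 by rewrite expf_neq0.
  have Xb : X ^+ b != 0 by rewrite expf_neq0.
  have -> : qpoch (t * X / Y) t 0 = 1 by rewrite /qpoch big_nil.
  rewrite ?expr0 ?mulr1 ?divr1 !exprD !exprS.
  have E : X * (1 - t * Y / X * t ^+ b) = X - Y * (t * t ^+ b) by field.
  move: (1 - t * Y / X * t ^+ b) E => D E.
  rewrite -E; move: (qpoch _ _ _) (t ^+ b) (X ^+ b) tb Xb => Q T Z T0 Z0 Q0 D0 YX0 XY0.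
  by field; do ?[apply/andP; split] => //.
have Eb : \prod_(0 <= l < b) (Y * t ^+ l / (Y * t ^+ l - X * t ^+ a.+1)) =
   \prod_(0 <= l < b) (Y * t ^+ l / (Y * t ^+ l - X * t ^+ a)) *
   ((Y * t ^+ b - X * t ^+ a.+1) / ((Y - X * t ^+ a.+1) * t ^+ b)).
  have := shift_prod Y (X * t ^+ a) b; rewrite mulrCA -exprS !prodf_div.
  have := YX a.+1 0%N; rewrite expr0 mulr1.
  have : \prod_(0 <= l < b) (Y * t ^+ l - X * t ^+ a) != 0.
    by rewrite big_mkord; apply/prodf_neq0.
  have : \prod_(0 <= l < b) (Y * t ^+ l - X * t ^+ a.+1) != 0.
    by rewrite big_mkord; apply/prodf_neq0.
  have : t ^+ b != 0 by rewrite expf_neq0.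
  move: (\prod_(0 <= l < b) (Y * t ^+ l)) => W; move: (\prod_(0 <= l < b) _) => P1.
  move: (\prod_(0 <= l < b) _) => P2; move: (t ^+ b) (t ^+ a.+1) => B A B0 P10 P20 A0 E.
  have -> : W / P1 = W / P2 * (P2 / P1) by field; rewrite P10 P20.
  congr (_ * _); have -> : P2 = P1 * (Y * B - X * A) / ((Y - X * A) * B).
    by rewrite E; field; rewrite ?A0 ?B0.
  by field; do ?[apply/andP; split] => //.
rewrite Eb big_nat_recr //= mulrACA IH {Eb IH} !qpochS binS bin1.
have := XY a b; have := XY a.+1 b; have := YX a.+1 0%N; have := qXY a.
have := q0 _ a qXY; have := q0 _ b qYX.
have : t ^+ b != 0 by rewrite expf_neq0.
have : t ^+ a != 0 by rewrite expf_neq0.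
have : X ^+ b != 0 by rewrite expf_neq0.
have : Y ^+ a != 0 by rewrite expf_neq0.
have : t ^+ (a * b) != 0 by rewrite expf_neq0.
rewrite mulSn !exprD !exprS ?expr0 ?mulr1.
have E : Y * (1 - t * X / Y * t ^+ a) = Y - X * (t * t ^+ a) by field.
move: (1 - t * X / Y * t ^+ a) E => D E; rewrite -E.
move: (qpoch _ _ _) (qpoch _ _ _) => Q1 Q2.
move: (t ^+ (a * b)) (t ^+ a) (t ^+ b) (X ^+ b) (Y ^+ a) (t ^+ 'C(a, 2)) (t ^+ 'C(b, 2))
  ((- X) ^+ a) ((- Y) ^+ b) => AB A B Xb Ya U V W Z.
move=> *; field; do ?[apply/andP; split] => //.
Qed.

End Pairs.

(** * Milne's identity *)

Section MilneSum.
Variables (F : fieldType) (n' : nat) (X : 'I_n'.+1 -> F) (t : F).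
Local Notation n := n'.+1.
Implicit Types (a b : 'I_n -> nat).
Hypotheses (t_neq0 : t != 0) (X_neq0 : forall c, X c != 0).
Hypothesis node_sep : forall c d i j, (c, i) != (d, j) -> X c * t ^+ i - X d * t ^+ j != 0.

Definition milne_term a : F :=
  \prod_c \prod_d \prod_(0 <= l < a c)
    (X c * t ^+ l / (X c * t ^+ l - X d * t ^+ a d)).

Lemma t_sep j : 1 - t * t ^+ j != 0.
Proof.
have := @node_sep ord0 ord0 0%N j.+1 isT; apply: contra => /eqP E.
by rewrite expr0 -mulrBr exprS E mulr0.
Qed.

(** [diag_term] treats [c = d] and [pair_term] the rest. The powers [t ^- (a c * a d)] combine with
    the binomials ['C(a c, 2)] into [t ^- 'C(r, 2)], by the expansion of the binomial of a sum. *)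
Lemma milne_termE a r : (\sum_c a c = r)%N ->
  milne_term a =
  (\prod_c \prod_d qpoch (t * X c / X d) t (a c))^-1 *
  (\prod_(c < n) \prod_(d < n | (c < d)%N)
     ((X c * t ^+ a c - X d * t ^+ a d) / (X c - X d))) *
  (-1) ^+ (n' * r) * (\prod_c (X c ^+ (n * a c) * t ^+ (n * 'C(a c, 2)))) /
  ((\prod_c X c) ^+ r * t ^+ 'C(r, 2)).
Proof.
move=> ar; rewrite /milne_term prod_pairs.
rewrite [X in X * _ = _](eq_bigr (fun c => (qpoch t t (a c))^-1)) => [|c _]; last first.
  by rewrite diag_term //; apply: t_sep.
rewrite [X in _ * X = _](eq_bigr (fun c : 'I_n => \prod_(d < n | (c < d)%N)
  ((qpoch (t * X c / X d) t (a c))^-1 * (qpoch (t * X d / X c) t (a d))^-1 *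
  ((X c * t ^+ a c - X d * t ^+ a d) / (X c - X d)) *
  (((- X c) ^+ a c / X c ^+ a d * t ^+ 'C(a c, 2)) *
   ((- X d) ^+ a d / X d ^+ a c * t ^+ 'C(a d, 2))) * t ^- (a c * a d)))) => [|c _]; last first.
  apply: eq_bigr => d cd; rewrite mulrC pair_term ?invfM // => i j.
  by apply: node_sep; apply/eqP => -[E]; rewrite E ltnn in cd.
under [X in _ * X = _]eq_bigr do rewrite 4!big_split /=.
rewrite 4!big_split /=.
rewrite [in RHS]prod_pairs; under [in RHS]eq_bigr do rewrite mulfK //.
(* The monomials are easy to multiply over all ordered pairs; dividing by the diagonal then gives
   the product [G] over [c < d]. *)
pose g c d := (- X c) ^+ a c / X c ^+ a d * t ^+ 'C(a c, 2).
have := prod_pairs g; rewrite /g.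
set G := \prod_(i < n) \prod_(j < n | _) _ => EG.
have tr : \prod_(c < n) \prod_(d < n | (c < d)%N) t ^- (a c * a d) =
   t ^+ (\sum_c 'C(a c, 2)) / t ^+ 'C(r, 2).
  rewrite -ar bin2_big_sum exprD invfM mulrA mulfV ?expf_neq0 // mul1r -prodrXr -prodfV.
  by apply: eq_bigr => c _; rewrite -prodrXr prodfV.
rewrite {}tr; set Q1 := \prod_(i < n) \prod_(j < n | _) _^-1.
set Q2 := \prod_(i < n) \prod_(j < n | _) _^-1.
rewrite [in RHS]invfM -prodfV.
have -> : \prod_(i < n) \prod_(j < n | (i < j)%N)
   (qpoch (t * X i / X j) t (a i) * qpoch (t * X j / X i) t (a j)) = (Q1 * Q2)^-1.
  rewrite /Q1 /Q2 -big_split -prodfV; apply: eq_bigr => i _; rewrite -big_split -prodfV.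
  by apply: eq_bigr => j _; rewrite /= invfM !invrK.
rewrite invrK -!mulrA; do 4!congr (_ * _).
have E1 : \prod_c \prod_d ((- X c) ^+ a c / X c ^+ a d * t ^+ 'C(a c, 2)) =
  (-1) ^+ (n * r) * (\prod_c (X c ^+ (n * a c) * t ^+ (n * 'C(a c, 2)))) / (\prod_c X c) ^+ r.
  rewrite -ar big_distrr /= -prodrXr -prodrXl -prodfV -!big_split /=.
  apply: eq_bigr => c _; rewrite big_split big_split /= !prodr_const card_ord.
  rewrite prodfV prodrXr ar -!exprM ![(_ * n)%N]mulnC [in LHS]exprNn; ring.
have E2 : \prod_c ((- X c) ^+ a c / X c ^+ a c * t ^+ 'C(a c, 2)) =
  (-1) ^+ r * t ^+ (\sum_c 'C(a c, 2)).
  rewrite -ar -!prodrXr -big_split /=; apply: eq_bigr => c _.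
  by rewrite (exprNn (X c)) mulfK // expf_neq0.
have t2 : t ^+ (\sum_c 'C(a c, 2)) != 0 by rewrite expf_neq0.
have sr : (-1) ^+ r != 0 :> F by rewrite signr_eq0.
move: EG; rewrite E1 E2 mulSn exprD => EG.
have -> : G = (-1) ^+ (n' * r) * (\prod_c (X c ^+ (n * a c) * t ^+ (n * 'C(a c, 2)))) /
    (\prod_c X c) ^+ r / t ^+ (\sum_c 'C(a c, 2)).
  apply: (mulfI (mulf_neq0 sr t2)); rewrite -EG.
  by field; rewrite t2 expf_neq0 //; apply/prodf_neq0.
have PX : \prod_c X c != 0 by apply/prodf_neq0.
by field; rewrite t2 !expf_neq0.
Qed.

Lemma inj_nodes a : injective (fun c => X c * t ^+ a c).
Proof.
move=> c d E; apply/eqP; apply: contraTT (eqxx (0 : F)) => cd.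
rewrite -{1}(subrr (X c * t ^+ a c)) {2}E; apply: node_sep.
by apply: contra cd => /eqP[->].
Qed.

Lemma sum_ratio a :
  \sum_c \prod_(d | d != c) (X c * t ^+ a c / (X c * t ^+ a c - X d * t ^+ a d)) = 1.
Proof.
have := @lagrange_sum F _ [set: 'I_n] (fun=> 0) (fun c => X c * t ^+ a c).
move=> /(_ (in2W (@inj_nodes a))).
rewrite [X in 1 - X](bigD1 ord0) ?inE //= !mul0r subr0 => lag.
apply: etrans (lag _) => [|c _]; last by rewrite mulf_neq0 ?expf_neq0.
apply: eq_big => c; rewrite ?inE // => _.
rewrite prodf_div [in RHS](bigD1 c) ?inE //= subr0 -mulf_div divff ?mul1r; last first.
  by rewrite mulf_neq0 ?expf_neq0.
by congr (_ / _); [apply: eq_big => d; rewrite ?inE ?subr0|apply: eq_bigl => d; rewrite !inE andbT].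
Qed.

(** The summand of [lagrange_sum] with [y = X] at the nodes [X c * t ^+ a c]. It vanishes for
    [a c = 0], so it selects the [a] that arise by raising the part [c] of another composition. *)
Definition raise_coef a c : F :=
  (\prod_d (X c * t ^+ a c - X d)) /
  (X c * t ^+ a c * \prod_(d | d != c) (X c * t ^+ a c - X d * t ^+ a d)).

Lemma sum_raise a r : (\sum_c a c = r)%N -> \sum_c raise_coef a c = 1 - t ^- r.
Proof.
move=> ar; have := @lagrange_sum F _ [set: 'I_n] X (fun c => X c * t ^+ a c).
move=> /(_ (in2W (@inj_nodes a))).
rewrite [X in 1 - X](_ : _ = t ^- r) => [<-|]; last 2 first.
- by move=> c _; rewrite mulf_neq0 ?expf_neq0.
- rewrite -ar -prodrXr -prodfV; apply: eq_big => c; rewrite ?inE // => _.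
  by rewrite invfM mulrA divff // mul1r.
apply: eq_big => c; rewrite ?inE // => _; congr (_ / (_ * _)).
  by apply: eq_bigl => d; rewrite inE.
by apply: eq_bigl => d; rewrite !inE andbT.
Qed.

(** Raising the part [c] changes only factors that involve [c]. The numerator and denominator of
    [raise_coef] cancel most of this change, and what is left besides the power of [t] is the
    summand of [sum_ratio] at [a]. *)
Lemma milne_incr a c r : (\sum_c a c = r)%N ->
  milne_term (incr a c) * raise_coef (incr a c) c =
  - t ^- r.+1 * (milne_term a *
    \prod_(d | d != c) (X c * t ^+ a c / (X c * t ^+ a c - X d * t ^+ a d))).
Proof.
move=> ar; set v := X c * t ^+ a c.
have v0 : v != 0 by rewrite mulf_neq0 ?expf_neq0.
have ic : incr a c c = (a c).+1 by rewrite /incr eqxx addn1.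
have id d : d != c -> incr a c d = a d by rewrite /incr => /negbTE ->; rewrite addn0.
(* The quotient of the new by the old factor, with [e] the row and [d] the class in the denominator.
   For [d = c] the denominators shift; for [e = c] the row has one factor more. *)
pose rho d e := if d == c then (if e == c then v else X e * t ^+ a e - t * v) /
   ((X e - t * v) * t ^+ a e) else if e == c then v / (v - X d * t ^+ a d) else 1.
pose R (b : 'I_n -> nat) d e := \prod_(0 <= l < b e) (X e * t ^+ l / (X e * t ^+ l - X d * t ^+ b d)).
have RE d e : R (incr a c) d e = R a d e * rho d e.
  rewrite /R /rho; case: (eqVneq d c) => [->|dc].
    rewrite ic.
    have S : \prod_(0 <= l < a e) (X e * t ^+ l / (X e * t ^+ l - X c * t ^+ (a c).+1)) *
       (X e * t ^+ a e - t * v)^-1 =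
       \prod_(0 <= l < a e) (X e * t ^+ l / (X e * t ^+ l - X c * t ^+ a c)) /
       ((X e - t * v) * t ^+ a e).
      rewrite !prodf_div -!mulrA -!invfM; congr (_ / _).
      have := shift_prod t (X e) v (a e); rewrite {1}/v mulrCA -exprS => ->.
      by rewrite mulrC.
    case: (eqVneq e c) S => [->|ec] S.
      have E : X c * t ^+ (a c).+1 = t * v by rewrite exprS mulrCA.
      rewrite ic big_nat_recr //= -/v E; rewrite -/v E in S.
      by rewrite [v / (v - _)]mulrC [LHS]mulrA S -[LHS]mulrA [_^-1 * v]mulrC.
    have nz : X e * t ^+ a e - t * v != 0.
      rewrite /v mulrCA -exprS; apply: node_sep; apply/eqP => -[E].
      by rewrite E eqxx in ec.
    by rewrite id // mulrA mulrAC -S mulfVK.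
  rewrite (id d) //; case: (eqVneq e c) => [->|ec]; last by rewrite id ?mulr1.
  by rewrite ic big_nat_recr.
have -> : milne_term (incr a c) = milne_term a * \prod_d \prod_e rho d e.
  rewrite /milne_term exchange_big [in RHS]exchange_big -big_split; apply: eq_bigr => d _.
  by rewrite -big_split; apply: eq_bigr => e _; exact: RE.
rewrite -[LHS]mulrA [RHS]mulrCA; congr (_ * _).
rewrite (bigD1 c) //= [X in X * _]mulrC.
rewrite [X in X * _ * _](eq_bigr (fun d => v / (v - X d * t ^+ a d))) => [|d dc]; last first.
  rewrite (bigD1 c) //= [X in _ * X]big1 => [|e ec]; rewrite /rho (negbTE dc) ?eqxx ?mulr1 //.
  by rewrite (negbTE ec).
rewrite -[LHS]mulrA [RHS]mulrC; congr (_ * _); rewrite /raise_coef ic.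
have -> : X c * t ^+ (a c).+1 = t * v by rewrite exprS mulrCA.
have -> : \prod_e rho c e = v * \prod_(e | e != c) (X e * t ^+ a e - t * v) /
   ((\prod_e (X e - t * v)) * t ^+ r).
  rewrite -ar -prodrXr -big_split /= /rho eqxx prodf_div (bigD1 c) //= eqxx.
  by congr (_ * _ / _); apply: eq_bigr => e /negbTE ->.
have -> : \prod_d (t * v - X d) = - (-1) ^+ n' * \prod_e (X e - t * v).
  rewrite -mulN1r -exprS -[X in _ ^+ X](card_ord n) -prodrN.
  by apply: eq_bigr => e _; rewrite opprB.
have -> : \prod_(d | d != c) (t * v - X d * t ^+ incr a c d) =
   (-1) ^+ n' * \prod_(e | e != c) (X e * t ^+ a e - t * v).
  rewrite (eq_bigr (fun d => - (X d * t ^+ a d - t * v))) => [|d dc].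
    by rewrite prodrN cardC1 card_ord.
  by rewrite id // opprB.
have nX : \prod_e (X e - t * v) != 0.
  apply/prodf_neq0 => e _; rewrite /v mulrCA -exprS -[X e]mulr1 -(expr0 t).
  by apply: node_sep; apply/eqP => -[].
have nZ : \prod_(e | e != c) (X e * t ^+ a e - t * v) != 0.
  apply/prodf_neq0 => e ec; rewrite /v mulrCA -exprS; apply: node_sep.
  by apply: contra ec => /eqP[->].
have sg : (-1) ^+ n' != 0 :> F by rewrite signr_eq0.
have tr : t ^+ r != 0 by rewrite expf_neq0.
rewrite exprS; move: sg tr nX nZ v0.
move: (\prod_e (X e - t * v)) => A; move: (\prod_(e | e != c) _) => B.
move: ((-1) ^+ n') (t ^+ r) => S W S0 W0 A0 B0 v1.
by field; do ?[apply/andP; split] => //.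
Qed.

(** Double counting of compositions with a marked positive part: [(b, c)] corresponds to
    [(incr b c, c)]. The bound [B] is independent of [r] so that both levels share one index
    type. *)
Lemma sum_incr (V : nmodType) B r (Phi : ('I_n -> nat) -> 'I_n -> V) :
  (r.+1 < B.+1)%N -> (forall a b c, a =1 b -> Phi a c = Phi b c) ->
  \sum_(b : {ffun 'I_n -> 'I_B.+1} | weak_comp r b) \sum_c Phi (incr (fun d => b d) c) c =
  \sum_(a : {ffun 'I_n -> 'I_B.+1} | weak_comp r.+1 a) \sum_(c | (0 < a c)%N) Phi (fun d => a d) c.
Proof.
move=> rB ePhi; rewrite exchange_big [RHS](exchange_big_dep xpredT) //=; apply: eq_bigr => c _.
pose inc (b : {ffun 'I_n -> 'I_B.+1}) : {ffun 'I_n -> 'I_B.+1} := [ffun d => inord (b d + (d == c))].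
pose dec (b : {ffun 'I_n -> 'I_B.+1}) : {ffun 'I_n -> 'I_B.+1} := [ffun d => inord (b d - (d == c))].
have decE (b : {ffun 'I_n -> 'I_B.+1}) d : dec b d = (b d - (d == c))%N :> nat.
  by rewrite ffunE inordK // (leq_ltn_trans (leq_subr _ _)).
have decK (b : {ffun 'I_n -> 'I_B.+1}) : (0 < b c)%N -> inc (dec b) = b.
  move=> bc; apply/ffunP => d; apply: val_inj; rewrite ffunE decE subnK ?inord_val //.
  by case: (eqVneq d c) => [->|].
have sum_dec (b : {ffun 'I_n -> 'I_B.+1}) s : (0 < b c)%N -> (\sum_d dec b d == s)%N = (\sum_d b d == s.+1)%N.
  move=> bc; rewrite -eqSS; congr (_ == _).
  under eq_bigr do rewrite decE.
  rewrite (bigD1 c) //= eqxx [in RHS](bigD1 c) //= -addSn subn1 prednK //; congr (_ + _)%N.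
  by apply: eq_bigr => d /negbTE ->; rewrite subn0.
rewrite [RHS](reindex_onto inc dec) /=; last by move=> b /andP[_]; apply: decK.
apply: eq_big => b; last first.
  move=> bb; apply: ePhi => d; rewrite ffunE inordK // /incr ltnS.
  have : (b d <= r)%N by rewrite -(eqP bb) (bigD1 d) //= leq_addr.
  by case: eqP => _ /=; rewrite ltnS in rB; lia.
case: (boolP (weak_comp r b)) => bb.
  have le_r d : (b d <= r)%N by rewrite -(eqP bb) (bigD1 d) //= leq_addr.
  have incE d : inc b d = (b d + (d == c))%N :> nat.
    by rewrite ffunE inordK // ltnS; have := le_r d; case: eqP => _ /=; rewrite ltnS in rB; lia.
  have incK : dec (inc b) = b.
    by apply/ffunP => d; apply: val_inj; rewrite [LHS]decE incE addnK.
  have ic0 : (0 < inc b c)%N by rewrite incE eqxx addn1.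
  by rewrite incK eqxx ic0 !andbT /weak_comp -sum_dec // incK; apply/esym.
apply/esym/negbTE; apply: contra bb => /andP[/andP[ib ic0] /eqP bE].
by rewrite /weak_comp -bE sum_dec.
Qed.

(** Splitting [1 - t ^- r.+1] by [sum_raise] and lowering the marked part by [milne_incr] reduces
    level [r.+1] to level [r], where the remaining weights sum to 1 by [sum_ratio]. *)
Lemma milne_sum_bounded B r : (r < B.+1)%N ->
  \sum_(a : {ffun 'I_n -> 'I_B.+1} | weak_comp r a) milne_term (fun c => a c) =
  (qpoch t t r)^-1.
Proof.
have eT a b : a =1 b -> milne_term a = milne_term b by move=> /funext ->.
have eR a b c : a =1 b -> raise_coef a c = raise_coef b c by move=> /funext ->.
elim: r => [|r IH] rB.
  rewrite (big_pred1 [ffun=> ord0]) => [|a].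
    rewrite /milne_term /qpoch big_nil invr1 big1 // => c _; rewrite big1 // => d _.
    by rewrite ffunE big_nil.
  rewrite /weak_comp sum_nat_eq0; apply/forallP/eqP => [a0|-> c]; last by rewrite ffunE.
  by apply/ffunP => c; apply: val_inj; rewrite ffunE; apply/eqP/a0.
have tr : 1 - t ^+ r.+1 != 0 by rewrite exprS t_sep.
have tr0 : t ^+ r.+1 != 0 by rewrite expf_neq0.
have key : (\sum_(a : {ffun 'I_n -> 'I_B.+1} | weak_comp r.+1 a)
    milne_term (fun c => a c)) * (1 - t ^- r.+1) = - t ^- r.+1 * (qpoch t t r)^-1.
  rewrite -(IH (ltnW rB)) mulr_suml.
  transitivity (\sum_(a : {ffun 'I_n -> 'I_B.+1} | weak_comp r.+1 a)
     \sum_(c | (0 < a c)%N) milne_term (fun c => a c) * raise_coef (fun c => a c) c).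
    apply: eq_bigr => a /eqP ar; rewrite -(sum_raise (a := fun c => a c) ar) mulr_sumr.
    rewrite [RHS]big_mkcond; apply: eq_bigr => c _; case: posnP => // ac.
    by rewrite /raise_coef (bigD1 c) //= ac expr0 mulr1 subrr !mul0r mulr0.
  rewrite -(sum_incr (Phi := fun a c => milne_term a * raise_coef a c)) //; last first.
    by move=> a b c ab; rewrite (eT _ _ ab) (eR _ _ _ ab).
  rewrite mulr_sumr; apply: eq_bigr => b /eqP br.
  under eq_bigr do rewrite (milne_incr _ br).
  by rewrite -!mulr_sumr sum_ratio mulr1.
rewrite qpochS -exprS invfM; apply: (mulIf (x := 1 - t ^- r.+1)).
  rewrite (_ : _ - _ = - t ^- r.+1 * (1 - t ^+ r.+1)); last by field.
  by rewrite mulf_neq0 // oppr_eq0 invr_eq0.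
have q0 : qpoch t t r != 0.
  by rewrite /qpoch big_mkord; apply/prodf_neq0 => j _; apply: t_sep.
by rewrite key; field; rewrite tr tr0 q0.
Qed.

End MilneSum.

(** * Orders and limits in Q((q)) *)

Lemma fcoefD (R : idomainType) (f g : fps R) d : fcoef (f + g) d = fcoef f d + fcoef g d.
Proof. by []. Qed.

Lemma fcoefN (R : idomainType) (f : fps R) d : fcoef (- f) d = - fcoef f d.
Proof. by []. Qed.

Lemma fcoefM (R : idomainType) (f g : fps R) d :
  fcoef (f * g) d = \sum_(i < d.+1) fcoef f i * fcoef g (d - i)%N.
Proof. by []. Qed.

Lemma fcoef1 (R : idomainType) d : fcoef (1 : fps R) d = (d == 0%N)%:R.
Proof. by []. Qed.

Lemma invrB (F : fieldType) (x y : F) : x != 0 -> y != 0 ->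
  x^-1 - y^-1 = - (x - y) * x^-1 * y^-1.
Proof. by move=> x0 y0; field; rewrite x0 y0. Qed.

Definition fpsX : fps rat := Fps (fun d => (d == 1%N)%:R).

Lemma fcoefXM (f : fps rat) d : fcoef (fpsX * f) d = if d is d'.+1 then fcoef f d' else 0.
Proof.
rewrite fcoefM; case: d => [|d]; first by rewrite big_ord1 /= mul0r.
rewrite (bigD1 (Ordinal (isT : 1 < d.+2)%N)) //= mul1r subSS subn0 big1 ?addr0 // => i ne.
by rewrite /= (_ : (i == 1 :> nat) = false) ?mul0r //; apply/negbTE; apply: contra ne => /eqP E;
  apply/eqP/val_inj.
Qed.

Lemma fcoefXnM k (f : fps rat) d :
  fcoef (fpsX ^+ k * f) d = if (k <= d)%N then fcoef f (d - k)%N else 0.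
Proof.
elim: k d => [|k IH] d; first by rewrite mul1r subn0.
by rewrite exprS -mulrA fcoefXM; case: d => [|d] //; rewrite IH ltnS subSS.
Qed.

Lemma fps_low_coef k (f : fps rat) : (forall d, (d < k)%N -> fcoef f d = 0) ->
  exists g, f = fpsX ^+ k * g.
Proof.
move=> f0; exists (Fps (fun d => fcoef f (d + k)%N)); apply: fpsP => d; rewrite fcoefXnM.
by case: leqP => [kd|/f0 //] /=; rewrite subnK.
Qed.

(** The geometric series; since [g] has no constant term, coefficient [d] only needs the powers up
    to [d]. *)
Lemma fps_unit_series (g : fps rat) : fcoef g 0%N = 0 -> exists h, h * (1 - g) = 1.
Proof.
move=> g0; have gk k d : (d < k)%N -> fcoef (g ^+ k) d = 0.
  have [|g' ->] := @fps_low_coef 1 g; first by case.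
  by rewrite expr1 exprMn fcoefXnM => dk; rewrite leqNgt dk.
pose h := Fps (fun d => fcoef (\sum_(k < d.+1) g ^+ k) d).
have hE d N : (d < N)%N -> fcoef h d = fcoef (\sum_(k < N) g ^+ k) d.
  move=> dN; rewrite /= -(subnKC dN); elim: (N - d.+1)%N => [|e IH]; first by rewrite addn0.
  by rewrite addnS [in RHS]big_ord_recr /= -IH gk ?addr0 // addSn ltnS leq_addr.
exists h; apply: fpsP => d; transitivity (fcoef ((\sum_(k < d.+1) g ^+ k) * (1 - g)) d).
  by rewrite !fcoefM; apply: eq_bigr => i _; rewrite (hE _ d.+1).
have -> : (\sum_(k < d.+1) g ^+ k) * (1 - g) = 1 - g ^+ d.+1.
  by rewrite mulrC -[LHS]opprK -mulNr opprB -subrX1 opprB.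
by rewrite fcoefD fcoefN gk ?subr0.
Qed.

Lemma qE : q = FracField.tofrac fpsX. Proof. by []. Qed.

Lemma q_neq0 : q != 0.
Proof.
rewrite qE tofrac_eq0; apply/eqP => /(congr1 (fun f => fcoef f 1%N)) /eqP.
by rewrite /= oner_eq0.
Qed.

(** A lower bound on the [q]-adic valuation, not its exact value: 0 has every order. *)
Definition has_order (d : int) (x : laurent) := exists f : fps rat, x = q ^ d * FracField.tofrac f.

Lemma qzD (d e : int) : q ^ (d + e) = q ^ d * q ^ e.
Proof. by rewrite expfzDr // q_neq0. Qed.

Lemma has_order0 d : has_order d 0.
Proof. by exists 0; rewrite tofrac0 mulr0. Qed.

Lemma has_orderD d x y : has_order d x -> has_order d y -> has_order d (x + y).
Proof. by move=> [f ->] [g ->]; exists (f + g); rewrite tofracD mulrDr. Qed.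

Lemma has_orderN d x : has_order d x -> has_order d (- x).
Proof. by move=> [f ->]; exists (- f); rewrite tofracN mulrN. Qed.

Lemma has_orderB d x y : has_order d x -> has_order d y -> has_order d (x - y).
Proof. by move=> Ox /has_orderN; apply: has_orderD. Qed.

Lemma has_orderM d e x y : has_order d x -> has_order e y -> has_order (d + e) (x * y).
Proof. by move=> [f ->] [g ->]; exists (f * g); rewrite tofracM qzD mulrACA. Qed.

Lemma has_order_le d e x : (e <= d)%R -> has_order d x -> has_order e x.
Proof.
move=> le_ed [f ->]; exists (fpsX ^+ `|d - e|%N * f).
by rewrite tofracM tofracXn -qE exprnP mulrA -qzD; congr (q ^ _ * _); lia.
Qed.

Lemma has_orderM0 d x y : has_order d x -> has_order 0 y -> has_order d (x * y).
Proof. by move=> Ox Oy; rewrite -[d]addr0; apply: has_orderM. Qed.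

Lemma has_order_qz d : has_order d (q ^ d).
Proof. by exists 1; rewrite tofrac1 mulr1. Qed.

Lemma has_order_tofrac f : has_order 0 (FracField.tofrac f).
Proof. by exists f; rewrite expr0z mul1r. Qed.

Lemma has_order_qX d : has_order d%:Z (q ^+ d).
Proof. exact: has_order_qz. Qed.

Lemma has_order_q0 d : has_order 0 (q ^+ d).
Proof. by apply: has_order_le (has_order_qX d). Qed.

Lemma has_order1 : has_order 0 1.
Proof. by exists 1; rewrite tofrac1 mulr1. Qed.

Lemma has_order_sum d I (s : seq I) (P : pred I) (G : I -> laurent) :
  (forall i, P i -> has_order d (G i)) -> has_order d (\sum_(i <- s | P i) G i).
Proof.
by move=> OG; elim/big_ind: _ => //; [apply: has_order0|move=> *; apply: has_orderD].
Qed.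

Lemma has_order_prod I (s : seq I) (P : pred I) (G : I -> laurent) :
  (forall i, P i -> has_order 0 (G i)) -> has_order 0 (\prod_(i <- s | P i) G i).
Proof.
by move=> OG; elim/big_ind: _ => //; [apply: has_order1|move=> *; apply: has_orderM0].
Qed.

Lemma has_order_exp k x : has_order 0 x -> has_order 0 (x ^+ k).
Proof. by move=> Ox; elim: k => [|k IH]; [apply: has_order1|rewrite exprS; apply: has_orderM0]. Qed.

Lemma has_order_coef (d : nat) f : has_order d%:Z (FracField.tofrac f) <->
  forall i, (i < d)%N -> fcoef f i = 0.
Proof.
split=> [[g E] i ltid|/fps_low_coef[g ->]].
  have /eqP : FracField.tofrac f = FracField.tofrac (fpsX ^+ d * g).
    by rewrite E tofracM tofracXn.
  by rewrite tofrac_eq => /eqP ->; rewrite fcoefXnM leqNgt ltid.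
by exists g; rewrite tofracM tofracXn.
Qed.

Lemma q_inj : injective (fun i : nat => q ^+ i).
Proof.
move=> i j /= E; apply/eqP; move/eqP: E; rewrite qE -!tofracXn tofrac_eq => /eqP E.
have cX k d : fcoef (fpsX ^+ k) d = (d == k)%:R.
  rewrite -[fpsX ^+ k]mulr1 fcoefXnM fcoef1 -leqn0 leq_subLR addn0.
  by rewrite (eqn_leq d k) andbC; case: leqP.
have := congr1 (fun f => fcoef f i) E; rewrite /= !cX eqxx.
by case: eqP => //= _ /eqP; rewrite oner_eq0.
Qed.

(** The group [1 + q Q[[q]]]. The Pochhammer denominators lie in it, so inverting them costs no
    order. *)
Definition unit1 x := has_order 1 (x - 1).

Lemma unit1_order x : unit1 x -> has_order 0 x.
Proof.
move=> x1; rewrite -(subrK 1 x); apply: has_orderD has_order1.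
by apply: has_order_le x1.
Qed.

Lemma unit1V x : unit1 x -> [/\ x != 0, has_order 0 x^-1 & unit1 x^-1].
Proof.
move=> x1; have [g xE] := x1.
have [|h hE] := @fps_unit_series (- (fpsX * g)); first by rewrite fcoefN fcoefXM oppr0.
have hx : FracField.tofrac h * x = 1.
  rewrite -tofrac1 -hE tofracM opprK tofracD tofrac1 tofracM -qE.
  by rewrite -[x](subrK 1) xE expr1z addrC.
have x0 : x != 0.
  by apply: contra_eqN hx => /eqP ->; rewrite mulr0 eq_sym oner_neq0.
have xV : x^-1 = FracField.tofrac h by rewrite -[LHS]mul1r -hx mulfK.
have xV0 : has_order 0 x^-1 by rewrite xV; apply: has_order_tofrac.
split=> //; rewrite /unit1 (_ : _ - 1 = - (x - 1) * x^-1).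
  by apply: has_orderM0 => //; apply: has_orderN.
by rewrite mulNr mulrBl mulfV // mul1r opprB.
Qed.

Lemma unit1_1 : unit1 1.
Proof. by rewrite /unit1 subrr; apply: has_order0. Qed.

Lemma unit1M x y : unit1 x -> unit1 y -> unit1 (x * y).
Proof.
move=> x1 y1; rewrite /unit1 (_ : _ - 1 = (x - 1) * y + (y - 1)); last by ring.
by apply: has_orderD => //; apply: has_orderM0 => //; apply: unit1_order.
Qed.

Lemma unit1_prod I (s : seq I) (P : pred I) (G : I -> laurent) :
  (forall i, P i -> unit1 (G i)) -> unit1 (\prod_(i <- s | P i) G i).
Proof.
by move=> OG; elim/big_ind: _ => //; [apply: unit1_1|move=> *; apply: unit1M].
Qed.

Lemma unit1X x k : unit1 x -> unit1 (x ^+ k).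
Proof. by move=> x1; elim: k => [|k IH]; [apply: unit1_1|rewrite exprS; apply: unit1M]. Qed.

Lemma unit1_1q j : (0 < j)%N -> unit1 (1 - q ^+ j).
Proof.
move=> j0; rewrite /unit1 addrAC subrr sub0r; apply: has_orderN.
by apply: has_order_le (has_order_qX j); lia.
Qed.

(** A nonzero series is a nonzero constant times a power of [q] times an element of [unit1], so
    dividing by it costs only finitely many orders. Needed for limits with poles in [lcvgM] and for
    the inverse Vandermonde product in [princ_lcvg]. *)
Lemma laurent_order x : exists d, has_order d x.
Proof.
have fpsE (f : fps rat) : f != 0 -> exists d, exists c : fps rat, exists2 u, unit1 u &
    FracField.tofrac f = FracField.tofrac c * q ^+ d * u /\ exists c', c' * c = 1.
  case/fps_neq0_order=> d fd lowf.
  have [g fE] := fps_low_coef lowf.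
  have g0 : fcoef g 0%N != 0 by move: fd; rewrite fE fcoefXnM leqnn subnn.
  pose cst (a : rat) : fps rat := Fps (fun d => if d is 0%N then a else 0).
  have cM a h e : fcoef (cst a * h) e = a * fcoef h e.
    rewrite fcoefM big_ord_recl /= subn0 big1 ?addr0 // => i _.
    by rewrite mul0r.
  have [|g' g'E] := @fps_low_coef 1 (cst (fcoef g 0%N)^-1 * g - 1).
    by move=> [|//] _; rewrite fcoefD fcoefN cM mulVf // fcoef1 subrr.
  have cK : cst (fcoef g 0%N)^-1 * cst (fcoef g 0%N) = 1.
    apply: fpsP => -[|e]; rewrite cM fcoef1 /= ?mulVf ?mulr0 //.
  exists d, (cst (fcoef g 0%N)), (FracField.tofrac (cst (fcoef g 0%N)^-1 * g)); last first.
    split; last by exists (cst (fcoef g 0%N)^-1).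
    by rewrite fE tofracM tofracXn -qE -mulrA mulrCA -tofracM mulrA [X in X * g]mulrC cK mul1r.
  rewrite /unit1 -tofrac1 -tofracB g'E tofracM tofracXn -qE.
  by apply: has_orderM0 (has_order_tofrac _); apply: has_order_qX.
have [f [g g0 ->]] : exists f, exists2 g : fps rat, g != 0 &
    x = FracField.tofrac f / FracField.tofrac g.
  exists (frac (repr x)).1, (frac (repr x)).2; first exact: denom_ratioP.
  apply: (canRL (mulfK _)); first by rewrite tofrac_eq0 denom_ratioP.
  unlock FracField.tofrac; rewrite -{1}[x]reprK -[LHS]FracField.pi_mul.
  apply/eqmodP; rewrite /= FracField.equivfE /FracField.mulf.
  by rewrite !numden_Ratio ?mulr1 ?mulf_neq0 ?denom_ratioP ?oner_neq0 // mulrC.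
have [d [c [u u1 [gE [c' cK]]]]] := fpsE _ g0; rewrite gE !invfM.
have cV : (FracField.tofrac c)^-1 = FracField.tofrac c'.
  have cK' : FracField.tofrac c' * FracField.tofrac c = 1 by rewrite -tofracM cK tofrac1.
  have c0 : FracField.tofrac c != 0.
    by apply: contra_eqN cK' => /eqP ->; rewrite mulr0 eq_sym oner_neq0.
  by rewrite -[LHS]mul1r -cK' mulfK.
exists (- d%:Z); have [_ u0 _] := unit1V u1.
rewrite mulrA; apply: has_orderM0 u0; rewrite mulrC; apply: has_orderM0 (has_order_tofrac _).
rewrite mulrC; apply: has_orderM0; last by rewrite cV; apply: has_order_tofrac.
by rewrite exprnN; apply: has_order_qz.
Qed.

(** Convergence in all of [Q((q))]; unlike in [fps_cvg], terms and limit may have poles, and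
    integrality is added separately by [lcvg_fps_cvg]. *)
Definition lcvg (u : nat -> laurent) (l : laurent) := forall d : nat, exists r0,
  forall r, (r0 <= r)%N -> has_order d%:Z (u r - l).

Lemma lcvg_ext u v l : (exists r0, forall r, (r0 <= r)%N -> u r = v r) -> lcvg u l -> lcvg v l.
Proof.
move=> [r1 E] cu d; have [r2 H] := cu d; exists (maxn r1 r2) => r.
by rewrite geq_max => /andP[/E <- /H].
Qed.

Lemma lcvg_cst l : lcvg (fun=> l) l.
Proof. by move=> d; exists 0%N => r _; rewrite subrr; apply: has_order0. Qed.

Lemma lcvgD u v k l : lcvg u k -> lcvg v l -> lcvg (fun r => u r + v r) (k + l).
Proof.
move=> cu cv d; have [r1 H1] := cu d; have [r2 H2] := cv d; exists (maxn r1 r2) => r.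
rewrite geq_max => /andP[/H1 O1 /H2 O2]; rewrite opprD addrACA; exact: has_orderD.
Qed.

Lemma lcvg_order0 u l : lcvg u l -> (forall r, has_order 0 (u r)) -> has_order 0 l.
Proof.
move=> cu Ou; have [r0 /(_ r0 (leqnn _)) H] := cu 0%N.
by rewrite -[l](subKr (u r0)); apply: has_orderB.
Qed.

Lemma lcvgM u v k l : lcvg u k -> lcvg v l -> lcvg (fun r => u r * v r) (k * l).
Proof.
move=> cu cv d; have [dk Ok] := laurent_order k; have [dl Ol] := laurent_order l.
have [r1 H1] := cu (d + `|dl|)%N; have [r2 H2] := cv (d + `|dk|)%N.
exists (maxn r1 r2) => r; rewrite geq_max => /andP[/H1 O1 /H2 O2].
rewrite (_ : _ - _ = (u r - k) * (v r - l) + ((u r - k) * l + (v r - l) * k)); last by ring.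
apply: has_orderD.
  by apply: has_order_le (has_orderM O1 O2); lia.
apply: has_orderD.
  by apply: has_order_le (has_orderM O1 Ol); lia.
by apply: has_order_le (has_orderM O2 Ok); lia.
Qed.

Lemma lcvg_sum I (s : seq I) (P : pred I) (u : I -> nat -> laurent) l :
  (forall i, P i -> lcvg (u i) (l i)) ->
  lcvg (fun r => \sum_(i <- s | P i) u i r) (\sum_(i <- s | P i) l i).
Proof.
move=> cu; elim: s => [|i s IH].
  by rewrite big_nil; apply: lcvg_ext (lcvg_cst 0); exists 0%N => r _; rewrite big_nil.
rewrite big_cons; case: ifP => Pi.
  apply: lcvg_ext (lcvgD (cu i Pi) IH).
  by exists 0%N => r _; rewrite big_cons Pi.
by apply: lcvg_ext IH; exists 0%N => r _; rewrite big_cons Pi.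
Qed.

Lemma lcvg_prod I (s : seq I) (P : pred I) (u : I -> nat -> laurent) l :
  (forall i, P i -> lcvg (u i) (l i)) ->
  lcvg (fun r => \prod_(i <- s | P i) u i r) (\prod_(i <- s | P i) l i).
Proof.
move=> cu; elim: s => [|i s IH].
  by rewrite big_nil; apply: lcvg_ext (lcvg_cst 1); exists 0%N => r _; rewrite big_nil.
rewrite big_cons; case: ifP => Pi.
  apply: lcvg_ext (lcvgM (cu i Pi) IH).
  by exists 0%N => r _; rewrite big_cons Pi.
by apply: lcvg_ext IH; exists 0%N => r _; rewrite big_cons Pi.
Qed.

Lemma lcvg_unit1 u l : lcvg u l -> (forall r, unit1 (u r)) -> unit1 l.
Proof.
move=> cu Ou; have [r0 /(_ r0 (leqnn _)) H] := cu 1%N.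
by rewrite /unit1 -[l](subKr (u r0)) addrAC; apply: has_orderB => //; apply: Ou.
Qed.

Lemma lcvgV u l : lcvg u l -> (forall r, unit1 (u r)) -> lcvg (fun r => (u r)^-1) l^-1.
Proof.
move=> cu Ou; have [l0 Ol _] := unit1V (lcvg_unit1 cu Ou) => d.
have [r0 H] := cu d; exists r0 => r /H Or; have [u0 Ou' _] := unit1V (Ou r).
rewrite invrB //; by do 2!apply: has_orderM0 => //; apply: has_orderN.
Qed.

Lemma lcvg_q e : lcvg (fun r => q ^+ (r + e)) 0.
Proof.
move=> d; exists d => r dr; rewrite subr0; apply: has_order_le (has_order_qX _); lia.
Qed.

Lemma lcvg_fps_cvg u l : lcvg u l -> (forall r, has_order 0 (u r)) -> fps_cvg u l.
Proof.
move=> cu Ou; have [g lE] := lcvg_order0 cu Ou.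
have /choice[f fE] : forall r, exists h, u r = FracField.tofrac h.
  by move=> r; have [h ->] := Ou r; exists h; rewrite expr0z mul1r.
rewrite expr0z mul1r in lE; exists f, g; split=> // d; have [r0 H] := cu d.+1.
exists r0 => r /H; rewrite fE lE -tofracB => /has_order_coef/(_ d (ltnSn d)).
by rewrite fcoefD fcoefN => /eqP; rewrite subr_eq0 => /eqP.
Qed.

(** Coefficient [d] is constant from index [d.+1] on, so the limit reads it off there. *)
Lemma lcvg_complete u : (forall r, has_order 0 (u r)) ->
  (forall r : nat, has_order r%:Z (u r.+1 - u r)) -> exists l, lcvg u l.
Proof.
move=> Ou Cu; have /choice[f fE] : forall r, exists h, u r = FracField.tofrac h.
  by move=> r; have [h ->] := Ou r; exists h; rewrite expr0z mul1r.
exists (FracField.tofrac (Fps (fun d => fcoef (f d.+1) d))) => d; exists d => r dr.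
rewrite fE -tofracB; apply/has_order_coef => i ltid; rewrite fcoefD fcoefN /=.
have ir : (i.+1 <= r)%N := leq_trans ltid dr.
rewrite -(subnKC ir); elim: (r - i.+1)%N => [|e IH]; first by rewrite addn0 subrr.
rewrite addnS -IH; congr (_ - _); apply/eqP; rewrite -subr_eq0; apply/eqP.
have := Cu (i.+1 + e)%N; rewrite !fE -tofracB => /has_order_coef/(_ i).
by rewrite fcoefD fcoefN; apply; lia.
Qed.

(** * Infinite q-Pochhammer symbols *)

Lemma has_order_prodB d I (s : seq I) (P : pred I) (x y : I -> laurent) :
  (forall i, P i -> has_order 0 (x i)) -> (forall i, P i -> has_order 0 (y i)) ->
  (forall i, P i -> has_order d (x i - y i)) ->
  has_order d (\prod_(i <- s | P i) x i - \prod_(i <- s | P i) y i).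
Proof.
move=> Ox Oy Oxy; elim: s => [|i s IH]; first by rewrite !big_nil subrr; apply: has_order0.
rewrite !big_cons; case: ifP => // Pi.
rewrite (_ : _ - _ = (x i - y i) * \prod_(j <- s | P j) x j +
  (\prod_(j <- s | P j) x j - \prod_(j <- s | P j) y j) * y i); last by ring.
by apply: has_orderD; apply: has_orderM0 => //; [apply: Oxy|apply: has_order_prod|apply: Oy].
Qed.

Lemma has_orderVB d x y : unit1 x -> unit1 y -> has_order d (x - y) ->
  has_order d (x^-1 - y^-1).
Proof.
move=> /unit1V[x0 Ox _] /unit1V[y0 Oy _] Oxy.
rewrite invrB //; by do 2!apply: has_orderM0 => //; apply: has_orderN.
Qed.

Section QPochhammer.
Variables (i p : nat).
Hypotheses (i_gt0 : (0 < i)%N) (p_gt0 : (0 < p)%N).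

Lemma qpoch_unit1 k : unit1 (qpoch (q ^+ i) (q ^+ p) k).
Proof. by apply: unit1_prod => j _; rewrite -exprM -exprD; apply: unit1_1q; lia. Qed.

Lemma qpoch_step k : has_order k%:Z
  (qpoch (q ^+ i) (q ^+ p) k.+1 - qpoch (q ^+ i) (q ^+ p) k).
Proof.
rewrite qpochS mulrBr mulr1 addrAC subrr sub0r -mulrN mulrC.
apply: has_orderM0 (unit1_order (qpoch_unit1 k)); apply: has_orderN.
by rewrite -exprM -exprD; apply: has_order_le (has_order_qX _); nia.
Qed.

Lemma qpoch_inf_lcvg : lcvg (qpoch (q ^+ i) (q ^+ p)) (qpoch_inf (q ^+ i) (q ^+ p)).
Proof.
have Ou k := unit1_order (qpoch_unit1 k).
have [l cl] := lcvg_complete Ou qpoch_step.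
by rewrite /qpoch_inf (fps_cvg_lim (lcvg_fps_cvg cl Ou)).
Qed.

Lemma qpoch_inf_unit1 : unit1 (qpoch_inf (q ^+ i) (q ^+ p)).
Proof. exact: lcvg_unit1 qpoch_inf_lcvg qpoch_unit1. Qed.

(** A rate of convergence independent of [i] and [p], as the estimates uniform in the composition
    [a] require. *)
Lemma qpoch_tail d k : (d <= k)%N ->
  has_order d%:Z (qpoch (q ^+ i) (q ^+ p) k - qpoch_inf (q ^+ i) (q ^+ p)).
Proof.
move=> dk; have [r0 H] := qpoch_inf_lcvg d.
have {H} := H _ (leq_maxl r0 k); rewrite -(subnKC (leq_maxr r0 k)).
elim: (maxn r0 k - k)%N => [|e IH]; first by rewrite addn0.
rewrite addnS => O1; apply: IH; rewrite -[X in X - _](subrK (qpoch (q ^+ i) (q ^+ p) (k + e).+1)).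
rewrite -addrA; apply: has_orderD O1; rewrite -opprB; apply: has_orderN.
by apply: has_order_le (qpoch_step _); lia.
Qed.

End QPochhammer.

Lemma has_order_eq0 x : (forall d : nat, has_order d%:Z x) -> x = 0.
Proof.
move=> Ox; have [f] := Ox 0%N; rewrite expr0z mul1r => fE; rewrite {x}fE in Ox *.
apply/eqP; rewrite tofrac_eq0; apply/eqP/fpsP => d.
by have /has_order_coef := Ox d.+1; apply.
Qed.

Lemma lcvg_uniq u k l : lcvg u k -> lcvg u l -> k = l.
Proof.
move=> ck cl; apply/eqP; rewrite -subr_eq0; apply/eqP/has_order_eq0 => d.
have [r1 H1] := ck d; have [r2 H2] := cl d.
have O1 := H1 _ (leq_maxl r1 r2); have O2 := H2 _ (leq_maxr r1 r2).
set v := u _ in O1 O2.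
by rewrite (_ : k - l = (v - l) - (v - k)); [apply: has_orderB|ring].
Qed.

Lemma lcvg_shift u l e : lcvg u l -> lcvg (fun r => u (r + e)%N) l.
Proof.
by move=> cu d; have [r0 H] := cu d; exists r0 => r rr; apply: H; rewrite (leq_trans rr) ?leq_addr.
Qed.

Lemma qpoch_inf_rec i p : (0 < i)%N -> (0 < p)%N ->
  qpoch_inf (q ^+ i) (q ^+ p) = (1 - q ^+ i) * qpoch_inf (q ^+ (p + i)) (q ^+ p).
Proof.
move=> i0 p0; apply: lcvg_uniq (lcvg_shift 1 (qpoch_inf_lcvg i0 p0)) _.
have pi0 : (0 < p + i)%N by lia.
apply: lcvg_ext (lcvgM (lcvg_cst (1 - q ^+ i)) (qpoch_inf_lcvg pi0 p0)).
exists 0%N => r _; rewrite addn1 /qpoch [in RHS]big_nat_recl //= expr0 mulr1; congr (_ * _).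
by apply: eq_bigr => j _; rewrite exprS mulrA -exprD addnC.
Qed.

(** The infinite products together run once through all exponents from [n - d] on; the finite
    product supplies the missing [1, ..., n - d - 1]. *)
Lemma qpoch_inf_classes n' d : (d < n'.+1)%N ->
  \prod_(c < n'.+1) qpoch_inf (q ^+ (n'.+1 + c - d)) (q ^+ n'.+1) *
    \prod_(1 <= j < n'.+1 - d) (1 - q ^+ j) = qpoch_inf q q.
Proof.
move=> dn; set n := n'.+1.
have c1 := qpoch_inf_lcvg (isT : 0 < 1)%N (isT : 0 < 1)%N; rewrite !expr1 in c1.
apply: (@lcvg_uniq (fun L => qpoch q q (n * L + (n' - d)))); last first.
  move=> e; have [r0 H] := c1 e; exists r0 => r rr; apply: H.
  by apply: leq_trans rr _; rewrite /n; nia.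
have ci0 (c : 'I_n) : (0 < n + c - d)%N by have := ltn_ord c; rewrite /n; lia.
apply: lcvg_ext (lcvgM (lcvg_prod (index_enum _) (P := xpredT)
  (fun c _ => qpoch_inf_lcvg (ci0 c) (isT : 0 < n)%N)) (lcvg_cst _)).
exists 0%N => L _; rewrite mulrC [RHS]/qpoch addnC.
rewrite [RHS](big_cat_nat (n := (n' - d)%N)) ?leq_addr //=; congr (_ * _).
  rewrite subSn 1?[(d <= _)%N]ltnS // big_add1 /=.
  by apply: eq_bigr => j _; rewrite -exprS.
rewrite -{1}[X in \prod_(X <= _ < _) _]add0n big_addn addKn /n big_nodes; apply: eq_bigr => c _.
apply: eq_bigr => l _; rewrite -exprS -exprM -exprD /node; congr (1 - q ^+ _); lia.
Qed.

(** * Infinitely many variables *)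

(** Among [k + 1] distinct naturals one is at least [k]; remove it and induct. *)
Lemma bin2_le_sumn s : uniq s -> ('C(size s, 2) <= sumn s)%N.
Proof.
move sz : (size s) => k; elim: k s sz => [|k IH] s sz us //.
have /hasP[x xs kx] : has (leq k) s.
  rewrite -[has _ _]negbK -all_predC; apply/negP => /allP lt.
  have sub : {subset s <= iota 0 k}.
    by move=> x xs; rewrite mem_iota add0n /= ltnNge; apply: lt.
  by have := uniq_leq_size us sub; rewrite size_iota sz ltnn.
rewrite (perm_sumn (perm_to_rem xs)) /= binS bin1 addnC leq_add //.
by apply: IH; rewrite ?rem_uniq // size_rem // sz.
Qed.

Lemma bin2_le_sum_inj N s (w : 'I_N -> nat) : injective w -> (s <= N)%N ->
  ('C(s, 2) <= \sum_(i < N | i < s) w i)%N.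
Proof.
move=> w_inj sN; rewrite (big_ord_narrow sN).
have := @bin2_le_sumn [seq w (widen_ord sN i) | i : 'I_s].
rewrite sumnE size_image card_ord big_image /=; apply.
by rewrite map_inj_uniq ?enum_uniq // => i j /w_inj /(congr1 val) /= /val_inj.
Qed.

(** Abel summation: the weight is [m - k] times the sum over the first [r] entries plus [k] times
    the sum over the first [r.+1], and these sums are at least ['C(r, 2)] and ['C(r, 2) + r]. Hence
    the normalising power in the theorem. *)
Lemma near_rect_weight N m r k (w : 'I_N -> nat) : injective w -> (k <= m)%N ->
  (r + (0 < k) <= N)%N ->
  (m * 'C(r, 2) + k * r <= \sum_(i < N) w i * nth 0 (near_rect m r k) i)%N.
Proof.
move=> w_inj km rN.
have -> : (\sum_(i < N) w i * nth 0 (near_rect m r k) i =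
  (m - k) * (\sum_(i < N | i < r) w i) + k * (\sum_(i < N | i < r.+1) w i))%N.
  rewrite !big_distrr [X in (X + _)%N]big_mkcond [X in (_ + X)%N]big_mkcond -big_split /=.
  apply: eq_bigr => i _; rewrite near_rect_nth nth_cat size_nseq nth_nseq ltnS.
  case: (ltngtP i r) => [lt|gt|->] //=.
  - by rewrite -mulnDl subnK // mulnC.
  - by rewrite -(subnSK gt) /= nth_nil muln0.
  by rewrite subnn mulnC.
have := bin2_le_sum_inj w_inj (leq_trans (leq_addr _ _) rN).
case: k km rN => [|k] km rN.
  by rewrite !mul0n !addn0 subn0; apply: leq_mul.
rewrite addn1 in rN; have := bin2_le_sum_inj w_inj rN; rewrite binS bin1.
move: (\sum_(i < N | i < r) w i)%N (\sum_(i < N | i < r.+1) w i)%N ('C(r, 2)) => A B C.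
by rewrite -{2}(subnK km); nia.
Qed.

Lemma divf_mul2l (F : fieldType) (a x y : F) : a != 0 -> a * x / (a * y) = x / y.
Proof. by move=> a0; rewrite -mulf_div divff // mul1r. Qed.

Lemma divq_mul2l i (x y : laurent) : q ^+ i * x / (q ^+ i * y) = x / y.
Proof. by apply: divf_mul2l; rewrite expf_neq0 ?q_neq0. Qed.

Lemma qsubE i j : (i <= j)%N -> q ^+ i - q ^+ j = q ^+ i * (1 - q ^+ (j - i)).
Proof. by move=> ij; rewrite mulrBr mulr1 -exprD subnKC. Qed.

Lemma has_order_hl_factor n i j : i != j ->
  has_order 0 ((q ^+ i - q ^+ n * q ^+ j) / (q ^+ i - q ^+ j)).
Proof.
rewrite neq_ltn -exprD => /orP[ij|ji].
  have inj : (i <= n + j)%N by rewrite (leq_trans (ltnW ij)) ?leq_addl.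
  rewrite (qsubE (ltnW ij)) (qsubE inj) divq_mul2l.
  have ij0 : (0 < j - i)%N by rewrite subn_gt0.
  have [_ O1 _] := unit1V (unit1_1q ij0); apply: has_orderM0 O1.
  by apply: has_orderB; [apply: has_order1|apply: has_order_q0].
have -> : q ^+ i - q ^+ j = - (q ^+ j * (1 - q ^+ (i - j))).
  by rewrite -qsubE 1?ltnW // opprB.
rewrite invrN mulrN; apply: has_orderN.
have -> : q ^+ i - q ^+ (n + j) = q ^+ j * (q ^+ (i - j) - q ^+ n).
  by rewrite mulrBr -!exprD subnKC 1?ltnW // addnC.
rewrite divq_mul2l.
have ji0 : (0 < i - j)%N by rewrite subn_gt0.
have [_ O1 _] := unit1V (unit1_1q ji0); apply: has_orderM0 O1.
by apply: has_orderB; apply: has_order_q0.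
Qed.

(** All factors but the monomial have order 0, whichever permutation is taken. This is the
    integrality that [fps_cvg] demands, for the limit in [N] and again after normalisation in
    [r]. *)
Lemma has_order_hl_Q n m r k N : (0 < n)%N -> (0 < m)%N -> (k <= m)%N ->
  has_order (m * 'C(r, 2) + k * r)%N%:Z
    (hl_Q (near_rect m r k) (q ^+ n) (fun i : 'I_N => q ^+ i)).
Proof.
move=> n0 m0 km; rewrite /hl_Q /hl_P near_rect_length //.
case: ifP => rN; last by rewrite mulr0; apply: has_order0.
have u1 j : unit1 (qpoch (q ^+ n) (q ^+ n) j) by apply: qpoch_unit1.
rewrite mulrC; apply: has_orderM0; last first.
  by apply: unit1_order; apply: unit1_prod => i _.
rewrite mulrC; apply: has_orderM0; last first.
  suff /unit1V[] : unit1 (hl_v (near_rect m r k) (q ^+ n) N) by [].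
  apply: unit1_prod => i _; apply: unit1M => //.
  have /unit1V[_ _ //] : unit1 ((1 - q ^+ n) ^+
     (if i is 0%N then (N - plength (near_rect m r k))%N else count_mem i (near_rect m r k))).
  by apply/unit1X/unit1_1q.
apply: has_order_sum => w _; apply: has_orderM0.
  rewrite (eq_bigr (fun i : 'I_N => q ^+ (w i * nth 0 (near_rect m r k) i)%N)) => [|i _].
    rewrite prodrXr; apply: has_order_le (has_order_qX _); rewrite lez_nat.
    by apply: near_rect_weight => // i j /val_inj /perm_inj.
  by rewrite exprM.
apply: has_order_prod => i _; apply: has_order_prod => j ij; apply: has_order_hl_factor.
by apply: contraTneq ij => /val_inj/perm_inj ->; rewrite ltnn.
Qed.

Section Limit.
Variables (n' m r k : nat).
Local Notation n := n'.+1.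
Local Notation t := (q ^+ n).
Hypothesis m_gt0 : (0 < m)%N.

(** The sum of all elements of the set described by [inS a]. *)
Definition node_weight (a : 'I_n -> nat) := (\sum_(c < n) (c * a c + n * 'C(a c, 2)))%N.

Definition corner_sum (a : 'I_n -> nat) : laurent :=
  \sum_c q ^+ (k * corner a c) *
    \prod_(d | d != c) (q ^+ corner a c / (q ^+ corner a c - q ^+ corner a d)).

Lemma node_qX (c : 'I_n) l : q ^+ node c l = q ^+ c * t ^+ l.
Proof. by rewrite -exprM -exprD. Qed.

Lemma lcvg_row_term a : lcvg (row_term q a m)
  (q ^+ (m * node_weight a) * milne_term (fun c : 'I_n => q ^+ c) t a).
Proof.
have -> : q ^+ (m * node_weight a) * milne_term (fun c : 'I_n => q ^+ c) t a =
   \prod_c \prod_(0 <= l < a c) (q ^+ (m * node c l) * (\prod_(i < n) q ^+ node c l /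
      \prod_c' (q ^+ node c l - q ^+ corner a c'))).
  rewrite /node_weight big_distrr -prodrXr -big_split /=; apply: eq_bigr => c _.
  rewrite exchange_big big_split /=; congr (_ * _).
    rewrite prodrXr -big_distrr /= big_split /= sum_nat_const_nat subn0 -big_distrr /=.
    by rewrite -bin2_sum [(a c * c)%N]mulnC.
  apply: eq_bigr => l _; rewrite -prodf_div; apply: eq_bigr => d _.
  by rewrite -!node_qX.
apply: lcvg_prod => c _; apply: lcvg_prod => l _.
apply: lcvgM (lcvg_cst _) (lcvgM _ (lcvg_cst _)).
apply: lcvg_prod => i _; rewrite -[X in lcvg _ X]subr0 -[in X in lcvg _ X]oppr0.
have := lcvgD (lcvg_cst (q ^+ node c l)) (lcvgM (lcvg_cst (-1)) (lcvg_q i)).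
rewrite mulr0 => H; rewrite oppr0 subr0 -[X in lcvg _ X]addr0.
by apply: lcvg_ext H; exists 0%N => N _; rewrite mulN1r.
Qed.

(** The factor [(1 - t)^-1] comes from [c' = c], where the corner of [incr a c] lies [n] above that
    of [a]. *)
Lemma lcvg_last_term a : lcvg (last_term q a k) ((1 - t)^-1 * corner_sum a).
Proof.
rewrite /corner_sum mulr_sumr; apply: lcvg_sum => c _.
have -> : (1 - t)^-1 * (q ^+ (k * corner a c) *
    \prod_(d | d != c) (q ^+ corner a c / (q ^+ corner a c - q ^+ corner a d))) =
   q ^+ (k * corner a c) * (\prod_(i < n) q ^+ corner a c /
      \prod_c' (q ^+ corner a c - q ^+ corner (incr a c) c')).
  rewrite mulrCA; congr (_ * _); rewrite -[RHS]prodf_div [in RHS](bigD1 c) //=.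
  congr (_ * _).
    have -> : corner (incr a c) c = (corner a c + n)%N.
      by rewrite /corner /incr eqxx addn1 /node mulnS addnCA addnC addnA.
    rewrite exprD -{2}[q ^+ corner a c]mulr1 -mulrBr invfM mulrA divff ?mul1r //.
    by rewrite expf_neq0 ?q_neq0.
  by apply: eq_bigr => d dc; rewrite /corner /incr (negbTE dc) addn0.
apply: lcvgM (lcvg_cst _) (lcvgM _ (lcvg_cst _)).
apply: lcvg_prod => i _.
have := lcvgD (lcvg_cst (q ^+ corner a c)) (lcvgM (lcvg_cst (-1)) (lcvg_q i)).
rewrite mulr0 addr0; apply: lcvg_ext.
by exists 0%N => N _; rewrite mulN1r.
Qed.

Lemma hl_Q_lcvg :
  lcvg (fun N => hl_Q (near_rect m r k) t (fun i : 'I_N => q ^+ i))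
  (qpoch t t r * \sum_(a : {ffun 'I_n -> 'I_r.+1} | weak_comp r a)
     q ^+ (m * node_weight (fun c => a c)) *
     milne_term (fun c : 'I_n => q ^+ c) t (fun c => a c) * corner_sum (fun c => a c)).
Proof.
have t1 : 1 - t != 0 by rewrite (qpow_neq1 q_inj).
(* For [k = 0] the quotient is [(1 - t ^+ (N - r))^-1]; for [k > 0] it is exactly 1. *)
have ratio : lcvg (fun N => qpoch t t (N - r.+1) / qpoch t t (N - (r + (0 < k)))) 1.
  case: (posnP k) => k0; last first.
    apply: lcvg_ext (lcvg_cst 1); exists 0%N => N _; rewrite addn1 divff //.
    by have [] := unit1V (@qpoch_unit1 n n isT isT (N - r.+1)).
  have H : lcvg (fun N => (1 - t * t ^+ N)^-1) 1.
    rewrite -[X in lcvg _ X]invr1; apply: lcvgV => [d|N]; last first.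
      by rewrite -exprS -exprM; apply: unit1_1q.
    exists d => N dN; rewrite addrAC subrr sub0r; apply: has_orderN.
    by rewrite -exprS -exprM; apply: has_order_le (has_order_qX _); nia.
  move=> d; have [r0 Hd] := H d; exists (r0 + r.+1)%N => N rN.
  have := Hd (N - r.+1)%N; rewrite addn0.
  have -> : (N - r = (N - r.+1).+1)%N by lia.
  rewrite qpochS invfM mulrA divff ?mul1r; first by apply; lia.
  by have [] := unit1V (@qpoch_unit1 n n isT isT (N - r.+1)).
have -> : qpoch t t r = (1 - t) * qpoch t t r * 1 * (1 - t)^-1.
  by rewrite mulr1 mulrAC divff // mul1r.
rewrite -[X in lcvg _ X]mulrA [X in lcvg _ (_ * X)]mulr_sumr.
have H : lcvg (fun N => (1 - t) * qpoch t t r *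
   (qpoch t t (N - r.+1) / qpoch t t (N - (r + (0 < k)))) *
  \sum_(a : {ffun 'I_n -> 'I_r.+1} | weak_comp r a)
     row_term q (fun c => a c) m N * last_term q (fun c => a c) k N) 
  ((1 - t) * qpoch t t r * 1 * \sum_(a : {ffun 'I_n -> 'I_r.+1} | weak_comp r a)
     (1 - t)^-1 * (q ^+ (m * node_weight (fun c => a c)) *
     milne_term (fun c : 'I_n => q ^+ c) t (fun c => a c) * corner_sum (fun c => a c))).
  apply: lcvgM (lcvgM (lcvg_cst _) ratio) _; apply: lcvg_sum => a _.
  by rewrite mulrCA; apply: lcvgM (lcvg_row_term _) (lcvg_last_term _).
apply: lcvg_ext H; exists (n * r.+1)%N => N rN.
by rewrite (hl_Q_near_rect q_inj).
Qed.

Lemma hl_Q_princE : (k <= m)%N ->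
  hl_Q_princ (near_rect m r k) t =
  qpoch t t r * \sum_(a : {ffun 'I_n -> 'I_r.+1} | weak_comp r a)
     q ^+ (m * node_weight (fun c => a c)) *
     milne_term (fun c : 'I_n => q ^+ c) t (fun c => a c) * corner_sum (fun c => a c).
Proof.
move=> km; apply/fps_cvg_lim/lcvg_fps_cvg; first exact: hl_Q_lcvg.
by move=> N; apply: has_order_le (has_order_hl_Q _ _ _ _ km).
Qed.

Lemma has_order_hl_Q_princ : (k <= m)%N ->
  has_order (m * 'C(r, 2) + k * r)%N%:Z (hl_Q_princ (near_rect m r k) t).
Proof.
move=> km; rewrite hl_Q_princE //; set l := _ * _; set E := (_ + _)%N.
have [r0 H] := hl_Q_lcvg E; have {}H := H _ (leqnn _).
rewrite -[l](subKr (hl_Q (near_rect m r k) t (fun i : 'I_r0 => q ^+ i))).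
by apply: has_orderB => //; apply: has_order_hl_Q.
Qed.

End Limit.

(** * Alternants and exponents *)

Definition vandermonde_prod (F : fieldType) n (v : 'I_n -> F) :=
  \prod_(i < n) \prod_(j < n | (i < j)%N) (v j - v i).

(** The [n' - c] factors that pair [c] with a larger index change sign, and [n' - c] has the parity
    of [c + n']. *)
Lemma vandermonde_prod_lift (F : fieldType) n' (v : 'I_n'.+1 -> F) (c : 'I_n'.+1) :
  vandermonde_prod v = (-1) ^+ (c + n') * \prod_(d | d != c) (v c - v d) *
    vandermonde_prod (fun i => v (lift c i)).
Proof.
rewrite /vandermonde_prod (bigD1_ord c) //=.
rewrite [X in _ * X](eq_bigr (fun i : 'I_n' => (if (lift c i < c)%N then v c - v (lift c i) else 1) *
  \prod_(j < n' | (i < j)%N) (v (lift c j) - v (lift c i)))) => [|i _]; last first.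
  rewrite big_mkcond (bigD1_ord c) //=; congr (_ * _); rewrite [RHS]big_mkcond.
  by apply: eq_bigr => j _; rewrite /= !ltnNge leq_bump2.
rewrite big_split mulrA; congr (_ * _); rewrite -(big_mkcond (fun i : 'I_n' => lift c i < c)%N).
rewrite [X in X * _]big_mkcond (bigD1_ord c) //= ltnn mul1r.
rewrite [X in _ = _ * X](_ : _ = \prod_(i < n') (v c - v (lift c i))); last first.
  rewrite big_mkcond (bigD1_ord c) //= eqxx mul1r; apply: eq_bigr => i _.
  by rewrite eq_sym neq_lift.
rewrite [X in _ * X = _]big_mkcond -big_split /=.
rewrite (eq_bigr (fun i : 'I_n' => (-1) ^+ (c <= i)%N * (v c - v (lift c i)))) => [|i _].
  rewrite big_split /= prodrXr; congr (_ * _).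
  have -> : (\sum_(i < n') (c <= i) = n' - c)%N.
    rewrite -(big_mkord xpredT (fun i => (c <= i) : nat)).
    have cn : (c <= n')%N by rewrite -ltnS.
    rewrite (big_cat_nat (n := c)) //= big_nat big1 ?add0n => [|i /andP[_ ic]]; last by rewrite leqNgt ic.
    rewrite big_nat (eq_bigr (fun=> 1%N)) => [|i /andP[-> _] //].
    by rewrite -big_nat sum_nat_const_nat muln1.
  have cn : (c <= n')%N by rewrite -ltnS.
  by rewrite -[RHS]signr_odd -[LHS]signr_odd oddB // addbC -oddD.
rewrite /= /bump; case: (leqP c i) => ci /=.
  rewrite add1n ltnS ci ltnNge (leq_trans ci) //= mulr1 expr1 mulN1r opprB //.
by rewrite add0n ci ltnNge ltnW //= !mul1r.
Qed.

(** The exponents of the alternant of the one-row shape [(k)]: the staircase with [k] added to its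
    top entry. *)
Definition near_stair n' k (j : 'I_n'.+1) : nat := if j == ord_max then (n' + k)%N else j.

Lemma signed_sum_vandermonde (F : fieldType) n (v : 'I_n -> F) :
  vandermonde_prod v = \sum_(s : 'S_n) (-1) ^+ s * \prod_c v c ^+ s c.
Proof.
have := det_Vandermonde (\row_i v i).
rewrite -det_tr /determinant /vandermonde_prod => E.
rewrite [LHS](eq_bigr (fun i : 'I_n => \prod_(j < n | (i < j)%N)
  ((\row_i v i) 0 j - (\row_i v i) 0 i))) => [|i _]; last first.
  by apply: eq_bigr => j _; rewrite !mxE.
rewrite -E; apply: eq_bigr => s _; congr (_ * _).
by apply: eq_bigr => i _; rewrite !mxE.
Qed.

(* The sum over [c] is the complete symmetric function h_k; this is the bialternant formula for it. *)
Lemma signed_sum_near_stair (F : fieldType) n' k (v : 'I_n'.+1 -> F) : injective v ->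
  vandermonde_prod v * (\sum_c v c ^+ k * \prod_(d | d != c) (v c / (v c - v d))) =
  \sum_(s : 'S_n'.+1) (-1) ^+ s * \prod_c v c ^+ near_stair k (s c).
Proof.
move=> v_inj; pose W := \matrix_(c < n'.+1, i < n'.+1) v c ^+ near_stair k i.
transitivity (\det W); last first.
  by apply: eq_bigr => s _; congr (_ * _); apply: eq_bigr => i _; rewrite mxE.
(* Only the last column involves [k], so the minors along it are ordinary Vandermonde
   determinants. *)
rewrite (expand_det_col W ord_max) mulr_sumr; apply: eq_bigr => c _.
rewrite mxE /near_stair eqxx /cofactor.
have -> : row' c (col' ord_max W) = (Vandermonde n' (\row_i v (lift c i)))^T.
  apply/matrixP => i j; rewrite !mxE /near_stair.
  by rewrite eq_sym (negbTE (neq_lift _ _)) lift_max.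
rewrite det_tr det_Vandermonde (vandermonde_prod_lift v c) prodf_div prodr_const cardC1 card_ord /=.
have -> : \prod_(i < n') \prod_(j < n' | (i < j)%N)
    ((\row_i v (lift c i)) 0 j - (\row_i v (lift c i)) 0 i) = vandermonde_prod (fun i => v (lift c i)).
  by apply: eq_bigr => i _; apply: eq_bigr => j _; rewrite !mxE.
have D0 : \prod_(d | d != c) (v c - v d) != 0.
  by apply/prodf_neq0 => d dc; rewrite subr_eq0; apply: contra dc => /eqP/v_inj ->.
rewrite [RHS]mulrC (exprD (v c)) /=; field; exact: D0.
Qed.

Section Exponent.
Variables (n' kappa : nat) (e : 'I_n'.+1 -> nat).
Local Notation n := n'.+1.
Implicit Types (a : 'I_n -> nat) (s : 'S_n).

Definition expo a s :=
  (\sum_(c < n) (kappa * (c * a c + n * 'C(a c, 2)) + e (s c) * (n * a c + c)))%N.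

(** The power of [q] in the denominator of [milne_termE] for variables [q ^+ e c] and base
    [q ^+ kappa]. *)
Definition expo_base r := ((\sum_c e c) * r + kappa * 'C(r, 2))%N.

Lemma bin2Z (i : nat) : ('C(i, 2))%:Z * 2 = i%:Z * (i%:Z - 1).
Proof. by elim: i => [|i IH] //; rewrite binS bin1; lia. Qed.

(** Completes the square around the balanced composition [a c = r / n]; the factor [2 * n] clears
    denominators. *)
Lemma expo_identity a s r : (\sum_c a c = r)%N ->
  (2 * n%:Z) * ((expo a s)%:Z - (expo_base r)%:Z) =
  \sum_(c < n) (kappa%:Z * ((n%:Z * (a c)%:Z - r%:Z) ^+ 2 + 2 * c%:Z * (n%:Z * (a c)%:Z - r%:Z))
     + 2 * n%:Z * (e (s c))%:Z * (n%:Z * (a c)%:Z - r%:Z + c%:Z)).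
Proof.
move=> ar; pose h (c : 'I_n) : int := kappa%:Z * ((n%:Z * (a c)%:Z - r%:Z) ^+ 2 +
  2 * c%:Z * (n%:Z * (a c)%:Z - r%:Z)) +
  2 * n%:Z * (e (s c))%:Z * (n%:Z * (a c)%:Z - r%:Z + c%:Z).
rewrite [RHS](eq_bigr h) //.
have sumZ (f : 'I_n -> nat) : \sum_c (f c)%:Z = (\sum_c f c)%N%:Z.
  by rewrite (big_morph Posz PoszD (erefl 0%:Z)).
have sumc : \sum_(c < n) c%:Z = 'C(n, 2)%:Z.
  by rewrite sumZ -bin2_sum big_mkord.
have H : \sum_(c < n) ((2 * n%:Z) * (kappa * (c * a c + n * 'C(a c, 2)) + e (s c) * (n * a c + c))%N%:Z - h c) =
   \sum_(c < n) (kappa%:Z * (2 * n%:Z * r%:Z - n%:Z ^+ 2) * (a c)%:Z + 2 * kappa%:Z * r%:Z * c%:Z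
     - kappa%:Z * r%:Z ^+ 2 + 2 * n%:Z * r%:Z * (e (s c))%:Z).
  apply: eq_bigr => c _; rewrite /h !(PoszD, PoszM).
  have := bin2Z (a c); move: ('C(a c, 2))%:Z => C; move: (a c)%:Z (e (s c))%:Z => A E CE.
  have -> : 2 * n%:Z * (kappa%:Z * (c%:Z * A + n%:Z * C) + E * (n%:Z * A + c%:Z)) =
    2 * n%:Z * (kappa%:Z * (c%:Z * A) + E * (n%:Z * A + c%:Z)) + n%:Z ^+ 2 * kappa%:Z * (C * 2) by ring.
  rewrite CE; ring.
clearbody h; move: H; rewrite !big_split /= -!mulr_sumr sumrN => /eqP; rewrite subr_eq => /eqP H.
rewrite mulrBr /expo -sumZ H.
rewrite !sumZ ar -sumZ sumc sumrN sumr_const card_ord.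
have -> : (\sum_c e (s c) = \sum_c e c)%N by rewrite [RHS](reindex_inj (@perm_inj _ s)).
rewrite /expo_base; have := bin2Z r; have := bin2Z n.
move: 'C(n, 2) 'C(r, 2) (\sum_c e c)%N (\sum_c h c) => C D S H0 CE DE.
rewrite !(PoszD, PoszM) -[_ *+ _]mulr_natr natz.
have -> : 2 * n%:Z * (S%:Z * r%:Z + kappa%:Z * D%:Z) =
  2 * n%:Z * S%:Z * r%:Z + n%:Z * kappa%:Z * (D%:Z * 2) by ring.
have -> : 2 * kappa%:Z * r%:Z * C%:Z = kappa%:Z * r%:Z * (C%:Z * 2) by ring.
by rewrite CE DE; ring.
Qed.

End Exponent.

(** * Bounds and the comparison identity *)

Section ExponentBounds.
Variables (n' kappa M : nat) (e : 'I_n'.+1 -> nat).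
Local Notation n := n'.+1.
Hypotheses (kappa_gt0 : (0 < kappa)%N) (e_le : forall c, (e c <= M)%N).
Implicit Types (a : 'I_n -> nat) (s : 'S_n).

(** Half the coefficient of the linear loss in [expo_term_ge]. *)
Definition expo_slack := (kappa * n + n * M)%N.
Local Notation G := expo_slack.

Lemma expo_term_ge (K c u N B d : int) : 1 <= K -> 0 <= c -> c <= N -> 0 <= u -> u <= B ->
  `|d| ^+ 2 - 2 * (K * N + N * B) * `|d| <= K * (d ^+ 2 + 2 * c * d) + 2 * N * u * (d + c).
Proof.
move=> K1 c0 cN u0 uB; rewrite real_normK ?num_real //.
have H1 : 0 <= (K - 1) * d ^+ 2 by apply: mulr_ge0; rewrite ?sqr_ge0 ?subr_ge0.
have D x : - `|x| <= x :> int by rewrite lerNl -normrN ler_norm.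
have H2 : - (N * `|d|) <= c * d.
  apply: le_trans (D _); rewrite normrM (ger0_norm c0) lerN2.
  by apply: ler_wpM2r.
have H3 : - (B * `|d|) <= u * d.
  apply: le_trans (D _); rewrite normrM (ger0_norm u0) lerN2.
  by apply: ler_wpM2r.
have H4 : 0 <= N * (u * c) by rewrite !mulr_ge0 // (le_trans c0).
have H5 : K * - (N * `|d|) <= K * (c * d) by rewrite ler_wpM2l // (le_trans _ K1).
have H6 : N * - (B * `|d|) <= N * (u * d) by rewrite ler_wpM2l // (le_trans c0).
move: H1 H4 H5 H6; rewrite expr2; lia.
Qed.

(** The class [c0] keeps its own bound; every other class contributes at least [- G ^ 2], the
    minimum of [D ^ 2 - 2 G D]. *)
Lemma expo_lower a s r (c0 : 'I_n) (d : int) : (\sum_c a c = r)%N ->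
  d = `|n%:Z * (a c0)%:Z - r%:Z| ->
  d ^+ 2 - 2 * G%:Z * d - (n * G ^ 2)%N%:Z <=
  (2 * n%:Z) * ((expo kappa e a s)%:Z - (expo_base kappa e r)%:Z).
Proof.
move=> ar ->; rewrite (expo_identity kappa e s ar) (bigD1 c0) //=.
apply: lerD.
  rewrite /G PoszD !PoszM; apply: expo_term_ge => //; rewrite ?lez_nat //.
  by rewrite ltnW.
apply: (@le_trans _ _ (\sum_(c < n | c != c0) - (G ^ 2)%N%:Z)).
  rewrite sumr_const cardC1 card_ord -mulr_natr natz /=.
  by move: (G ^ 2)%N => W; nia.
apply: ler_sum => c _.
have := @expo_term_ge kappa%:Z c%:Z (e (s c))%:Z n%:Z M%:Z (n%:Z * (a c)%:Z - r%:Z).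
rewrite !lez_nat => /(_ kappa_gt0 isT (ltnW (ltn_ord c)) isT (e_le _)).
apply: le_trans; rewrite (_ : _ + n%:Z * _ = G%:Z) //.
move: `|_| => D; have : 0 <= (D - G%:Z) ^+ 2 by apply: sqr_ge0.
by rewrite !expr2 -mulnn PoszM; nia.
Qed.

Lemma expo_ge a s r : (\sum_c a c = r)%N ->
  - (G ^ 2 + n * G ^ 2)%N%:Z <= (expo kappa e a s)%:Z - (expo_base kappa e r)%:Z.
Proof.
move=> ar; have := @expo_lower a s r ord0 _ ar erefl; rewrite PoszD.
move: (_ - _ : int) `|_| ((n * G ^ 2)%N) => E D W.
have : 0 <= (D - G%:Z) ^+ 2 by apply: sqr_ge0.
by rewrite !expr2 -mulnn PoszM; nia.
Qed.

(** A part at most [L] forces a deviation [D >= 2nd + nG^2 + 2G + 1]. Then [D - 2G >= 1], so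
    [D^2 - 2GD >= D], which covers both [nG^2] and [2nd]. *)
Lemma expo_large a s r d L c : (\sum_c a c = r)%N -> (a c <= L)%N ->
  (n * L + (2 * n * d + n * G ^ 2 + 2 * G + 1) <= r)%N ->
  d%:Z <= (expo kappa e a s)%:Z - (expo_base kappa e r)%:Z.
Proof.
move=> ar aL Lr; have := @expo_lower a s r c _ ar erefl.
have U0 : (2 * n * d)%N%:Z = 2 * n%:Z * d%:Z by rewrite !PoszM.
have D0 : (2 * n * d + n * G ^ 2 + 2 * G + 1)%N%:Z <= `|n%:Z * (a c)%:Z - r%:Z|.
  rewrite distrC; apply: le_trans (ler_norm _); rewrite lerBrDr -PoszM -PoszD lez_nat.
  by apply: leq_trans Lr; rewrite addnC leq_add2r leq_mul2l aL orbT.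
move: D0 U0; move: `|_| ((expo _ _ _ _)%:Z - _) (2 * n * d)%N (n * G ^ 2)%N => D E U W D0 U0.
rewrite expr2 => H.
have H2 : D * 1 <= D * (D - 2 * G%:Z) by apply: ler_wpM2l; lia.
have H3 : 2 * n%:Z * d%:Z <= 2 * n%:Z * E by lia.
by rewrite ler_pM2l in H3.
Qed.

End ExponentBounds.

Lemma sign_cancel (F : fieldType) (D S V g Q W : F) : V != 0 -> g * g = 1 ->
  D * S * (Q * W) = g * V * (D * (S / V) * g * Q * W).
Proof. by move=> V0 gg; rewrite -[LHS]mul1r -gg; field. Qed.

Section System.
Variables (n' kappa : nat) (e : 'I_n'.+1 -> nat).
Local Notation n := n'.+1.
Hypotheses (e_inj : injective e) (e_lt : forall c, (e c < kappa)%N).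
Implicit Types (a : 'I_n -> nat).
Local Notation X := (fun c : 'I_n => q ^+ e c).
Local Notation p := (q ^+ kappa).

Let kappa_gt0 : (0 < kappa)%N.
Proof. exact: leq_ltn_trans (e_lt ord0). Qed.

Lemma system_sep (c d : 'I_n) i j : (c, i) != (d, j) -> X c * p ^+ i - X d * p ^+ j != 0.
Proof.
move=> cd; rewrite -!exprM -!exprD; apply: (qpow_neq q_inj); apply: contra cd => /eqP E.
have /e_inj cdE : e c = e d.
  have := congr1 (modn^~ kappa) E; rewrite ![(kappa * _)%N]mulnC ![(e _ + _)%N]addnC.
  by rewrite !modnMDl !modn_small.
by move: E; rewrite cdE => /addnI/eqP; rewrite eqn_pmul2l // => /eqP ->.
Qed.

(** For level [n] and [e] the identity this is [B]; for level [m + n] and [near_stair] it is [B'].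
    Adding [kappa] first keeps the natural subtraction exact, since [e d < kappa]. *)
Definition den a : laurent :=
  \prod_c \prod_d qpoch (q ^+ (kappa + e c - e d)) p (a c).

Definition den_inf : laurent :=
  \prod_c \prod_d qpoch_inf (q ^+ (kappa + e c - e d)) p.

Lemma diff_gt0 c d : (0 < kappa + e c - e d)%N.
Proof. have := e_lt d; lia. Qed.

Lemma den_unit1 a : unit1 (den a).
Proof. by do 2!apply: unit1_prod => ? _; apply: qpoch_unit1 => //; apply: diff_gt0. Qed.

Lemma den_inf_unit1 : unit1 den_inf.
Proof. by do 2!apply: unit1_prod => ? _; apply: qpoch_inf_unit1 => //; apply: diff_gt0. Qed.

Lemma den_tail a L : (forall c, L <= a c)%N -> has_order L%:Z ((den a)^-1 - den_inf^-1).
Proof.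
move=> La; apply: has_orderVB; [exact: den_unit1|exact: den_inf_unit1|].
have O1 c d k := unit1_order (@qpoch_unit1 _ _ (diff_gt0 c d) kappa_gt0 k).
have O2 c d := unit1_order (@qpoch_inf_unit1 _ _ (diff_gt0 c d) kappa_gt0).
apply: has_order_prodB => c _; try by apply: has_order_prod => d _.
by apply: has_order_prodB => d _ //; apply: qpoch_tail => //; apply: diff_gt0.
Qed.

Lemma system_milneE a r : (\sum_c a c = r)%N ->
  milne_term X p a = (den a)^-1 *
  (vandermonde_prod (fun c => q ^+ (e c + kappa * a c)) / vandermonde_prod X) *
  (-1) ^+ (n' * r) * q ^+ (\sum_c (n * (e c * a c) + kappa * (n * 'C(a c, 2)))) /
  q ^+ expo_base kappa e r.
Proof.
move=> ar; rewrite (milne_termE _ _ system_sep ar) ?expf_neq0 ?q_neq0 //; last first.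
  by move=> c; rewrite expf_neq0 ?q_neq0.
congr (_^-1 * _ * _ * _ / _).
- apply: eq_bigr => c _; apply: eq_bigr => d _; congr (qpoch _ _ _).
  have le_d : (e d <= kappa + e c)%N by have := e_lt d; lia.
  by rewrite -exprD -[in LHS](subnK le_d) exprD mulfK // expf_neq0 ?q_neq0.
- rewrite /vandermonde_prod -prodf_div; apply: eq_bigr => c _.
  rewrite -prodf_div; apply: eq_bigr => d _.
  by rewrite -!exprM -!exprD -[X in X / _]opprB -[X in _ / X]opprB invrN mulrNN.
- rewrite -prodrXr; apply: eq_bigr => c _.
  by rewrite -!exprM -exprD; congr (q ^+ (_ + _)); rewrite mulnCA.
by rewrite prodrXr -!exprM -exprD /expo_base.
Qed.

Lemma vandermonde_X_neq0 : vandermonde_prod X != 0.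
Proof.
apply/prodf_neq0 => c _; apply/prodf_neq0 => d cd; apply: (qpow_neq q_inj).
by apply: contraTneq cd => /e_inj ->; rewrite ltnn.
Qed.

(** Milne's identity with its Vandermonde product expanded over [s]. Replacing [s] by its inverse
    and permuting [a] accordingly turns the exponent into [expo], at the price of a permuted
    argument of [den]. *)
Lemma system_sum r :
  \sum_(a : {ffun 'I_n -> 'I_r.+1} | weak_comp r a) \sum_(s : 'S_n)
     (den (fun c => a (s^-1%g c)))^-1 *
     ((-1) ^+ s * q ^+ expo kappa e (fun c => a c) s / q ^+ expo_base kappa e r) =
  (-1) ^+ (n' * r) * vandermonde_prod X / qpoch p p r.
Proof.
have p0 : p != 0 by rewrite expf_neq0 ?q_neq0.
have X0 c : X c != 0 by rewrite expf_neq0 ?q_neq0.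
have V0 := vandermonde_X_neq0.
rewrite -(milne_sum_bounded p0 X0 system_sep (ltnSn r)) mulr_sumr.
rewrite exchange_big /= (reindex_inj invg_inj) /=.
transitivity (\sum_(s : 'S_n) \sum_(a : {ffun 'I_n -> 'I_r.+1} | weak_comp r a)
  (den (fun c => a c))^-1 * ((-1) ^+ s * \prod_c (q ^+ (e c + kappa * a c)) ^+ s c) *
  (q ^+ (\sum_c (n * (e c * a c) + kappa * (n * 'C(a c, 2)))) / q ^+ expo_base kappa e r)).
  apply: eq_bigr => s _; pose h (s : 'S_n) (a : {ffun 'I_n -> 'I_r.+1}) := [ffun c => a (s c)].
  rewrite (reindex_onto (h s^-1%g) (h s)) /=; last first.
    by move=> a _; apply/ffunP => c; rewrite !ffunE permKV.
  apply: eq_big => [a|a _].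
    have -> : h s (h s^-1%g a) = a by apply/ffunP => c; rewrite !ffunE permK.
    rewrite eqxx andbT /weak_comp [in RHS](reindex_inj (@perm_inj _ s^-1%g)) /=.
    by congr (_ == _); apply: eq_bigr => c _; rewrite ffunE.
  have -> : (fun c => h s^-1%g a (s^-1^-1%g c) : nat) = (fun c => a c : nat).
    by apply/funext => c; rewrite ffunE invgK permK.
  rewrite odd_permV -!mulrA; congr (_ * (_ * _)); rewrite mulrA; congr (_ / _).
  rewrite (eq_bigr (fun c => q ^+ ((e c + kappa * a c) * s c))) => [|c _]; last by rewrite exprM.
  rewrite prodrXr -exprD -big_split /=; congr (q ^+ _).
  rewrite /expo (reindex_inj (@perm_inj _ s)); apply: eq_bigr => c _ /=.
  rewrite ffunE permK; move: (nat_of_ord (s c)) (nat_of_ord (a c)) ('C(a c, 2)) => u v w; nia.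
rewrite exchange_big; apply: eq_bigr => a /eqP ar.
rewrite (system_milneE (a := fun c => a c) ar) (signed_sum_vandermonde (fun c => q ^+ (e c + kappa * a c))).
rewrite -mulr_suml -mulr_sumr.
set S := \sum_s _; set V := vandermonde_prod _ in V0 *.
have sg : (-1) ^+ (n' * r) * (-1) ^+ (n' * r) = 1 :> laurent by rewrite -expr2 sqrr_sign.
by apply: sign_cancel.
Qed.

End System.

(** * The limit in r *)

Lemma expo_rearrange (F : fieldType) (D A W S B : F) :
  D * (S * (A * B) / W) = D * (A / W) * (S * B).
Proof. ring. Qed.

Lemma princ_rearrange (F : fieldType) (e0 x D V Delta g y b C : F) :
  e0^-1 * (x * (D * (V / Delta) * g * y / b) * C) =
  g / Delta * (D * (x * y / (e0 * b)) * (V * C)).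
Proof. rewrite invfM; ring. Qed.

Section NearStair.
Variables (n' k : nat).
Local Notation n := n'.+1.
Local Notation idn := (fun c : 'I_n => c : nat).
Local Notation stair := (@near_stair n' k).

Lemma idn_inj : injective idn. Proof. exact: val_inj. Qed.
Lemma idn_lt c : (idn c < n)%N. Proof. exact: ltn_ord. Qed.

Lemma stair_inj : injective stair.
Proof.
have small (i : 'I_n) : i != ord_max -> (i < n')%N.
  by move=> i_max; rewrite ltn_neqAle -ltnS ltn_ord andbT.
move=> i j; rewrite /near_stair.
case: (eqVneq i ord_max) (small i) => [->|_] si; case: (eqVneq j ord_max) (small j) => [->|_] sj //.
- by move=> E; have := sj isT; lia.
- by move=> E; have := si isT; lia.
exact: val_inj.
Qed.

Lemma stair_le c : (stair c <= n' + k)%N.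
Proof. by rewrite /near_stair; case: eqP => // _; have := ltn_ord c; lia. Qed.

Lemma sum_idn : (\sum_(c < n) c = 'C(n, 2))%N.
Proof. by rewrite -bin2_sum big_mkord. Qed.

Lemma sum_stair : (\sum_c stair c = 'C(n, 2) + k)%N.
Proof.
rewrite big_ord_recr /= /near_stair eqxx -sum_idn big_ord_recr /= addnA; congr (_ + _ + _)%N.
by apply: eq_bigr => i _; rewrite -val_eqE /= ltn_eqF.
Qed.

End NearStair.

Section Assembly.
Variables (n' m k : nat).
Local Notation n := n'.+1.
Local Notation kappa := (m + n)%N.
Local Notation t := (q ^+ n).
Local Notation p := (q ^+ kappa).
Hypotheses (m_gt0 : (0 < m)%N) (le_km : (k <= m)%N).

Local Notation idn := (fun c : 'I_n => c : nat).
Local Notation stair := (@near_stair n' k).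

Lemma stair_lt c : (stair c < kappa)%N.
Proof. by have := stair_le k c; lia. Qed.

(** The bialternant form of [corner_sum] cancels the Vandermonde factor of [milne_term]. The weights
    [m] and [n] of [node_weight] add to [kappa], and the normalising exponent is exactly the
    difference of the two [expo_base], so the summands become those of [system_sum] up to [den]. *)
Lemma princE r :
  q ^- (m * 'C(r, 2) + k * r) * hl_Q_princ (near_rect m r k) t =
  qpoch t t r * (-1) ^+ (n' * r) / vandermonde_prod (fun c : 'I_n => q ^+ c) *
  \sum_(a : {ffun 'I_n -> 'I_r.+1} | weak_comp r a) \sum_(s : 'S_n)
     (den n idn (fun c => a c))^-1 *
     ((-1) ^+ s * q ^+ expo kappa stair (fun c => a c) s / q ^+ expo_base kappa stair r).
Proof.
rewrite hl_Q_princE // mulrCA -!mulrA; congr (_ * _); rewrite mulrA !mulr_sumr.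
apply: eq_bigr => a /eqP ar.
rewrite (system_milneE (@idn_inj n') (@idn_lt n') (a := fun c => a c) ar).
have v_inj : injective (fun c => q ^+ corner (fun c => a c : nat) c).
  by move=> c d /q_inj /node_inj[].
rewrite (eq_bigr (fun s : 'S_n => (den n idn (fun c => a c))^-1 *
   (q ^+ (\sum_(c < n) kappa * (c * a c + n * 'C(a c, 2))) / q ^+ expo_base kappa stair r) *
   ((-1) ^+ s * \prod_c (q ^+ corner (fun c => a c : nat) c) ^+ stair (s c)))) => [|s _]; last first.
  rewrite (eq_bigr (fun c => q ^+ (corner (fun c => a c : nat) c * stair (s c)))); last first.
    by move=> c _; rewrite exprM.
  rewrite prodrXr /expo big_split exprD /=.
  have -> : (\sum_(c < n) stair (s c) * (n * a c + c) =
      \sum_c corner (fun c => a c : nat) c * stair (s c))%N.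
    by apply: eq_bigr => c _; rewrite mulnC /corner /node addnC.
  exact: expo_rearrange.
rewrite -mulr_sumr -(signed_sum_near_stair k v_inj).
have -> : \sum_c (q ^+ corner (fun c => a c : nat) c) ^+ k * \prod_(d | d != c)
    (q ^+ corner (fun c => a c : nat) c / (q ^+ corner (fun c => a c : nat) c -
     q ^+ corner (fun c => a c : nat) d)) = corner_sum k (fun c => a c).
  by apply: eq_bigr => c _; rewrite -exprM mulnC.
have -> : expo_base kappa stair r = ((m * 'C(r, 2) + k * r) + expo_base n idn r)%N.
  by rewrite /expo_base sum_stair sum_idn; move: 'C(n, 2) 'C(r, 2) => A B; rewrite !mulnDl; lia.
have -> : (\sum_(c < n) kappa * (c * a c + n * 'C(a c, 2)) =
   m * node_weight (fun c => a c) + \sum_c (n * (idn c * a c) + n * (n * 'C(a c, 2))))%N.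
  rewrite /node_weight big_distrr -big_split; apply: eq_bigr => c _ /=.
  by move: (nat_of_ord (a c)) ('C(a c, 2)) => A B; nia.
rewrite (exprD _ (_ + _) (expo_base _ _ _)) (exprD _ (m * _) (\sum_c _)).
exact: princ_rearrange.
Qed.

End Assembly.

(** [S2] is Milne's sum and [P] its Pochhammer symbol. Reading the closed form backwards turns the
    comparison term into [b * S2], so the difference can be formed coefficient by coefficient. *)
Lemma limit_rearrange (F : fieldType) (T g V1 V2 b P S1 S2 : F) :
  g * g = 1 -> S2 = g * V2 / P ->
  T * g / V1 * S1 - T * (b * (V2 / V1)) / P = T * g / V1 * (S1 - b * S2).
Proof.
move=> gg ->; rewrite mulrBr; congr (_ - _).
by rewrite -[LHS]mul1r -gg; ring.
Qed.

Lemma product_rearrange (F : fieldType) N (T P Q A D1 D2 W1 W2 S : F) :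
  D1 != 0 -> W1 != 0 -> S != 0 -> P != 0 ->
  D1 * W1 = Q ^+ N.+1 -> D2 * W2 = P ^+ N.+1 * A ->
  T * (D2 / D1 * ((S * W2) / (S * W1))) / P = T * P ^+ N / Q ^+ N.+1 * A.
Proof.
move=> D10 W10 S0 P0 <- E.
have -> : T * (D2 / D1 * ((S * W2) / (S * W1))) / P = T * (D2 * W2) / (D1 * W1) / P.
  by field; rewrite D10 W10 S0 P0.
by rewrite E exprS; field; rewrite D10 W10 P0.
Qed.

(** * Theta products for the limiting constants *)

Section Products.
Variables (n' kappa : nat) (e : 'I_n'.+1 -> nat).
Local Notation n := n'.+1.

Definition gap_prod : laurent := \prod_(i < n) \prod_(j < n | (i < j)%N) (1 - q ^+ (e j - e i)).

(** Only the smaller index of a pair contributes a monomial, and it is never the last index. So the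
    monomials for [near_stair] and for the identity coincide and cancel in the quotient. *)
Lemma vandermonde_gap : {homo e : i j / (i < j)%N} ->
  (forall i : 'I_n, (i < n')%N -> e i = i) ->
  vandermonde_prod (fun c => q ^+ e c) =
  (\prod_(i < n) \prod_(j < n | (i < j)%N) - q ^+ i) * gap_prod.
Proof.
move=> e_mono eE; rewrite /vandermonde_prod /gap_prod -big_split; apply: eq_bigr => i _.
rewrite -big_split; apply: eq_bigr => j ij /=.
have i_lt : (i < n')%N by apply: leq_trans ij _; rewrite -ltnS.
by rewrite -[LHS]opprB (qsubE (ltnW (e_mono _ _ ij))) mulNr -[in RHS](eE i i_lt).
Qed.

Lemma gap_prod_unit1 : {homo e : i j / (i < j)%N} -> unit1 gap_prod.
Proof.
move=> e_mono; apply: unit1_prod => i _; apply: unit1_prod => j ij.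
by apply: unit1_1q; rewrite subn_gt0; apply: e_mono.
Qed.

(** For a pair at distance [d], the factor [1 - q ^+ d] completes the symbol starting at [kappa + d]
    to one starting at [d]; with the symbol starting at [kappa - d] this is a theta function. The
    diagonal gives the power of [(p; p)]. *)
Lemma den_inf_gap : {homo e : i j / (i < j)%N} -> (forall c, (e c < kappa)%N) ->
  den_inf kappa e * gap_prod =
  qpoch_inf (q ^+ kappa) (q ^+ kappa) ^+ n *
  \prod_(i < n) \prod_(j < n | (i < j)%N) theta (q ^+ (e j - e i)) (q ^+ kappa).
Proof.
move=> e_mono e_lt; rewrite /den_inf prod_pairs.
rewrite [X in X * _ * _](eq_bigr (fun=> qpoch_inf (q ^+ kappa) (q ^+ kappa))) => [|i _]; last first.
  by rewrite addnK.
rewrite prodr_const card_ord -mulrA; congr (_ * _); rewrite /gap_prod -big_split.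
apply: eq_bigr => i _; rewrite -big_split; apply: eq_bigr => j ij /=.
have eij := e_mono _ _ ij; have ej := e_lt j.
have d0 : (0 < e j - e i)%N by rewrite subn_gt0.
have k0 : (0 < kappa)%N by lia.
rewrite /theta (qpoch_inf_rec d0 k0) [LHS]mulrC -[RHS]mulrA; congr (_ * _).
rewrite mulrC; congr (_ * _).
  by congr (qpoch_inf (q ^+ _) _); lia.
congr (qpoch_inf _ _).
have dk : (e j - e i <= kappa)%N by lia.
rewrite -[in RHS](subnK dk) exprD mulfK ?expf_neq0 ?q_neq0 //.
by congr (q ^+ _); lia.
Qed.

End Products.

(** For each fixed [d], the factors over [c] and the gaps above [d] form one copy of [(q; q)] by
    [qpoch_inf_classes]. *)
Lemma den_inf_id n' :
  den_inf n'.+1 (fun c : 'I_n'.+1 => c : nat) * gap_prod (fun c : 'I_n'.+1 => c : nat) =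
  qpoch_inf q q ^+ n'.+1.
Proof.
rewrite /den_inf exchange_big /gap_prod -big_split /=.
rewrite (eq_bigr (fun=> qpoch_inf q q)) => [|d _]; first by rewrite prodr_const card_ord.
rewrite -(qpoch_inf_classes (ltn_ord d)); congr (_ * _).
rewrite -(big_mkord (fun j => d < j)%N (fun j => 1 - q ^+ (j - d))).
rewrite (eq_bigl (fun j => true && (d.+1 <= j)%N)) // -big_nat_widenl //.
rewrite -{1}[d.+1]addn0 addSn -addnS addnC big_addn.
by apply: eq_bigr => j _; rewrite addnK.
Qed.

(** Pairs with the last index give exponents [n' + k - i], which become [i + k] on reversing the
    range; the other pairs do not see [k]. *)
Lemma theta_stair_prod n' k (p : laurent) :
  \prod_(i < n'.+1) \prod_(j < n'.+1 | (i < j)%N)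
     theta (q ^+ (near_stair k j - near_stair k i)) p =
  (\prod_(1 <= i < n'.+1) theta (q ^+ (i + k)) p) *
  \prod_(1 <= i < n'.+1) \prod_(i.+1 <= j < n'.+1) theta (q ^+ (j - i)) p.
Proof.
rewrite big_ord_recr /= [X in _ * X]big1 ?mulr1 => [|j]; last by rewrite ltnNge -ltnS ltn_ord.
have st (i : 'I_n') : near_stair k (widen_ord (leqnSn n') i) = i :> nat.
  by rewrite /near_stair -val_eqE /= ltn_eqF.
rewrite (eq_bigr (fun i : 'I_n' => theta (q ^+ (n' + k - i)) p *
   \prod_(j < n' | (i < j)%N) theta (q ^+ (j - i)) p)) => [|i _]; last first.
  rewrite big_mkcond big_ord_recr /= ltn_ord mulrC /near_stair eqxx -/(near_stair k _) st.
  congr (_ * _); rewrite [RHS]big_mkcond; apply: eq_bigr => j _.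
  by rewrite -/(near_stair k _) st.
rewrite big_split /=; congr (_ * _).
  rewrite big_add1 /= big_mkord (reindex_inj rev_ord_inj); apply: eq_bigr => i _ /=.
  by congr (theta (q ^+ _) _); have := ltn_ord i; lia.
rewrite big_add1 /= big_mkord; apply: eq_bigr => i _.
rewrite big_add1 /= -(big_mkord (fun j => i < j)%N (fun j => theta (q ^+ (j - i)) p)).
rewrite (eq_bigl (fun j => true && (i.+1 <= j)%N)) // -big_nat_widenl //.
Qed.

Section MainLimit.
Variables (n' m k : nat).
Local Notation n := n'.+1.
Local Notation kappa := (m + n)%N.
Local Notation t := (q ^+ n).
Local Notation p := (q ^+ kappa).
Hypotheses (m_gt0 : (0 < m)%N) (le_km : (k <= m)%N).

Local Notation idn := (fun c : 'I_n => c : nat).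
Local Notation stair := (@near_stair n' k).
Let kappa_gt0 : (0 < kappa)%N. Proof. by rewrite addnS. Qed.

Definition char_limit : laurent :=
  qpoch_inf t t * (den_inf kappa stair / den_inf n idn *
    (vandermonde_prod (fun c => q ^+ stair c) / vandermonde_prod (fun c => q ^+ idn c))) /
  qpoch_inf p p.

Lemma princ_lcvg :
  lcvg (fun r => q ^- (m * 'C(r, 2) + k * r) * hl_Q_princ (near_rect m r k) t) char_limit.
Proof.
set b := den_inf kappa stair / den_inf n idn.
set V1 := vandermonde_prod (fun c => q ^+ idn c).
set V2 := vandermonde_prod (fun c => q ^+ stair c).
have main : lcvg (fun r => qpoch t t r * (b * (V2 / V1)) / qpoch p p r) char_limit.
  apply: lcvgM (lcvgM _ (lcvg_cst _)) _; first exact: qpoch_inf_lcvg.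
  by apply: lcvgV => [|r]; [apply: qpoch_inf_lcvg|apply: qpoch_unit1].
have [dV OV] := laurent_order V1^-1.
have u1 : unit1 (den_inf n idn) by apply: den_inf_unit1 => c; apply: idn_lt.
have u2 : unit1 (den_inf kappa stair) by apply: den_inf_unit1 => c; apply: stair_lt.
have Ob : has_order 0 b.
  by apply: has_orderM0; [apply: unit1_order|have [] := unit1V u1].
(* The factor [b] is chosen so that both parts of [coef] have the same limit when all parts of [a]
   grow. *)
pose coef (a : 'I_n -> nat) (s : 'S_n) :=
  (den n idn a)^-1 - b * (den kappa stair (fun c => a (s^-1%g c)))^-1.
have u1a a : unit1 (den n idn a) by apply: den_unit1 => c; apply: idn_lt.
have u2a a : unit1 (den kappa stair a) by apply: den_unit1 => c; apply: stair_lt.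
have coef0 a s : has_order 0 (coef a s).
  apply: has_orderB; first by have [] := unit1V (u1a a).
  by apply: has_orderM0 Ob _; have [] := unit1V (u2a (fun c => a (s^-1%g c))).
have coefL a s L : (forall c, L <= a c)%N -> has_order L%:Z (coef a s).
  move=> La.
  have bE : b * (den_inf kappa stair)^-1 = (den_inf n idn)^-1.
    have [u20 _ _] := unit1V u2; rewrite /b mulrAC divff // mul1r //.
  have -> : coef a s = ((den n idn a)^-1 - (den_inf n idn)^-1) -
      ((den kappa stair (fun c => a (s^-1%g c)))^-1 - (den_inf kappa stair)^-1) * b.
    rewrite mulrBl [_^-1 * b in X in _ - (_ - X)]mulrC bE /coef opprB addrA subrK.
    by rewrite [b * _]mulrC.
  apply: has_orderB; first by apply: den_tail => //; apply: idn_lt.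
  by apply: has_orderM0 Ob; apply: den_tail => // c; apply: stair_lt.
move=> d; have [r1 H1] := main d.
(* [n' + k] bounds the entries of [stair]; [C] is the depth of negative exponents from [expo_ge];
   [D] allows for the pole of [V1^-1]. So [L = D + C] suffices for the coefficients, and the
   threshold for [r] is that of [expo_large] at [D]. *)
pose G := expo_slack n' kappa (n' + k); pose C := (G ^ 2 + n * G ^ 2)%N.
pose D := (d + `|dV|)%N; pose L := (D + C)%N.
exists (maxn r1 (n * L + (2 * n * D + n * G ^ 2 + 2 * G + 1)))%N => r.
rewrite geq_max => /andP[/H1 Or rL].
rewrite -(subrK (qpoch t t r * (b * (V2 / V1)) / qpoch p p r) (_ * hl_Q_princ _ _)) -addrA.
apply: has_orderD Or; rewrite princE //.
have sg : (-1) ^+ (n' * r) * (-1) ^+ (n' * r) = 1 :> laurent by rewrite -expr2 sqrr_sign.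
have S2 := @system_sum n' kappa stair (@stair_inj n' k) (stair_lt m_gt0 le_km) r.
rewrite (limit_rearrange _ _ b _ sg S2) mulr_sumr -sumrB.
have Osg : has_order 0 ((-1) ^+ (n' * r) : laurent).
  by apply/has_order_exp/has_orderN/has_order1.
suff OS : has_order D%:Z (\sum_(a : {ffun 'I_n -> 'I_r.+1} | weak_comp r a)
   (\sum_(s : 'S_n) (den n idn (fun c => a c))^-1 *
     ((-1) ^+ s * q ^+ expo kappa stair (fun c => a c) s / q ^+ expo_base kappa stair r) -
    b * \sum_(s : 'S_n) (den kappa stair (fun c => a (s^-1%g c)))^-1 *
     ((-1) ^+ s * q ^+ expo kappa stair (fun c => a c) s / q ^+ expo_base kappa stair r))).
  have := has_orderM (has_orderM (has_orderM0 (unit1_order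
    (@qpoch_unit1 n n isT isT r)) Osg) OV) OS.
  by apply: has_order_le; rewrite /D; lia.
apply: has_order_sum => a /eqP ar; rewrite mulr_sumr -sumrB; apply: has_order_sum => s _.
rewrite (mulrA b) -mulrBl -/(coef (fun c => a c) s).
have OZ : has_order ((expo kappa stair (fun c => a c) s)%:Z - (expo_base kappa stair r)%:Z)
   ((-1) ^+ s * q ^+ expo kappa stair (fun c => a c) s / q ^+ expo_base kappa stair r).
  rewrite -mulrA mulrC; apply: has_orderM0; last by apply/has_order_exp/has_orderN/has_order1.
  by have := has_order_qz ((expo kappa stair (fun c => a c) s)%:Z - (expo_base kappa stair r)%:Z);
    rewrite qzD exprnN.
(* If some part is at most [L], the exponent alone is large enough; otherwise the coefficient has
   order [L] and outweighs an exponent no lower than [- C]. *)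
have [/existsP[c aL]|/existsPn aL] := boolP [exists c, a c <= L]%N.
  rewrite mulrC; apply: has_orderM0 (coef0 _ _); apply: has_order_le OZ.
  exact: (@expo_large _ _ _ _ kappa_gt0 (@stair_le n' k) (fun c => a c) s _ _ _ c ar aL rL).
have La c : (L <= a c)%N by rewrite ltnW // ltnNge aL.
have := has_orderM (coefL (fun c => a c) s L La) OZ; apply: has_order_le.
have := @expo_ge _ _ _ _ kappa_gt0 (@stair_le n' k) (fun c => a c) s _ ar.
by rewrite -/G -/C /L PoszD; lia.
Qed.

Lemma char_limitE : char_limit =
  qpoch_inf t t * qpoch_inf p p ^+ n' / qpoch_inf q q ^+ n *
     (\prod_(1 <= i < n) theta (q ^+ (i + k)) p) *
     \prod_(1 <= i < n) \prod_(i.+1 <= j < n) theta (q ^+ (j - i)) p.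
Proof.
have stair_mono : {homo stair : i j / (i < j)%N}.
  move=> i j ij; rewrite /near_stair.
  have -> : (i == ord_max) = false.
    by apply/negbTE; rewrite -val_eqE /= neq_ltn (leq_trans ij) // -ltnS.
  by case: eqP => // jE; move: ij; rewrite jE /=; lia.
have stair_id (i : 'I_n) : (i < n')%N -> stair i = i.
  by move=> i_lt; rewrite /near_stair -val_eqE /= ltn_eqF.
have id_mono : {homo idn : i j / (i < j)%N} by [].
rewrite /char_limit (vandermonde_gap stair_mono stair_id) (vandermonde_gap id_mono) //.
rewrite -[RHS]mulrA -theta_stair_prod; apply: product_rearrange.
- by have [] := unit1V (@den_inf_unit1 n' n idn (@idn_lt n')).
- by have [] := unit1V (gap_prod_unit1 id_mono).
- by apply/prodf_neq0 => i _; apply/prodf_neq0 => j _; rewrite oppr_eq0 expf_neq0 ?q_neq0.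
- by have [] := unit1V (qpoch_inf_unit1 kappa_gt0 kappa_gt0).
- exact: den_inf_id.
exact: (den_inf_gap stair_mono (stair_lt m_gt0 le_km)).
Qed.

End MainLimit.

Theorem theorem4p1 (m n k : nat) (m_gt0 : (0 < m)%N) (n_gt0 : (0 < n)%N)
    (le_k_m : (k <= m)%N) :
  let kappa := (m + n)%N in
  fps_cvg
    (fun r => q ^- (m * 'C(r, 2) + k * r) *
              hl_Q_princ (near_rect m r k) (q ^+ n))
    (qpoch_inf (q ^+ n) (q ^+ n) *
       qpoch_inf (q ^+ kappa) (q ^+ kappa) ^+ (n - 1) /
       qpoch_inf q q ^+ n *
     (\prod_(1 <= i < n) theta (q ^+ (i + k)) (q ^+ kappa)) *
     \prod_(1 <= i < n) \prod_(i.+1 <= j < n) theta (q ^+ (j - i)) (q ^+ kappa)).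
Proof.
case: n n_gt0 => // n' _ kappa; rewrite subn1 /= -char_limitE //.
apply: lcvg_fps_cvg; first exact: princ_lcvg.
(* Each normalised term is a genuine power series, because the order bound on [Q] equals the power
   of [q] divided out. *)
move=> r; have := has_orderM (has_order_qz (- (m * 'C(r, 2) + k * r)%N%:Z))
  (has_order_hl_Q_princ n' r m_gt0 le_k_m).
by rewrite addNr exprnN.
Qed.
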